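(* Let $d\ge 1$ and let $\xi_1,\ldots,\xi_{d+1}$ be (possibly dependent) random vectors in $\mathbb{R}^d$ with partial sums $S_0=0$ and $S_i=\xi_1+\cdots+\xi_i$ for $1\le i\le d+1$. Assume: (Ex) for every permutation $\sigma$ of $\{1,\ldots,d+1\}$, $(\xi_{\sigma(1)},\ldots,\xi_{\sigma(d+1)})$ has the same distribution as $(\xi_1,\ldots,\xi_{d+1})$; (GP) for every $1\le i_1<\cdots<i_d\le d+1$, the probability that $S_{i_1},\ldots,S_{i_d}$ are linearly dependent is $0$. Let $\mathcal{Q}_{d+1,d}=\mathrm{conv}(S_0,S_1,\ldots,S_{d+1})$. Then, for all $m\in\{0,1,\ldots,\lfloor d/2\rfloor\}$, $$ \mathbb{P}[\mathcal{Q}_{d+1,d} \text{ is of type } T_m^{d}] = \eta_{d,m} \cdot \frac{1}{(d+1)!}\left\langle {d+1 \atop m}\right\rangle . $$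
   Context: $\left\langle {n\atop k}\right\rangle$, $k\in\{0,\ldots,n-1\}$, is the Eulerian number: the number of permutations of $\{1,\ldots,n\}$ in which exactly $k$ elements are greater than the previous element. Combinatorial types: the convex hull of $d+2$ points in $\mathbb{R}^d$ in general affine position (no $d+1$ of them on a common affine hyperplane) is a $d$-dimensional simplicial polytope with at most $d+2$ vertices. There are exactly $\lfloor d/2\rfloor+1$ combinatorial types of such polytopes, denoted $T_0^d,\ldots,T_{\lfloor d/2\rfloor}^d$. A $d$-dimensional polytope $T$ is of type $T_m^d$ if and only if $T=\mathrm{conv}(V\cup W)$ for disjoint sets $V=\{v_0,\ldots,v_m\}$ and $W=\{w_0,\ldots,w_{d-m}\}$ such that $\mathrm{conv}\,V$ and $\mathrm{conv}\,W$ are simplices intersecting in a single point which lies in the relative interior of each of them. In particular, $T_0^d$ is the type of a $d$-simplex; for $m\ge 1$ type $T_m^d$ has exactly $d+2$ vertices; type $T_m^d$ has exactly $(m+1)(d+1-m)$ facets. $\eta_{d,m}:=2$ if $m\ne d/2$, and $\eta_{d,m}:=1$ if $m=d/2$. *)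

(* Defs.v *)
From HB Require Import structures.
From mathcomp Require Import all_boot all_order all_algebra all_fingroup.
From mathcomp Require Import all_classical all_reals all_analysis.

Set Implicit Arguments.
Unset Strict Implicit.
Unset Printing Implicit Defensive.

Import Order.TTheory GRing.Theory Num.Theory.
Import numFieldNormedType.Exports.

Definition ascents n (s : 'S_n) : {set 'I_n} :=
  [set i : 'I_n | [exists j : 'I_n, (j.+1 == i :> nat) && (s j < s i)%N]].

Definition eulerian (n k : nat) : nat := #|[set s : 'S_n | #|ascents s| == k]|.

(* [m.*2 == d] is the exact equality m = d/2: it fails for odd d. *)
Definition eta (d m : nat) : nat := if m.*2 == d then 1 else 2.

Local Open Scope classical_set_scope.
Local Open Scope ring_scope.

Definition convex_hull (R : realType) n (A : set 'rV[R]_n) : set 'rV[R]_n :=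
  smallest (@convex_set R 'rV[R]_n) A.

Definition affine_set (R : realType) n (A : set 'rV[R]_n) : Prop :=
  forall x y (t : R), A x -> A y -> A (t *: x + (1 - t) *: y).

Definition affine_hull (R : realType) n (A : set 'rV[R]_n) : set 'rV[R]_n :=
  smallest (@affine_set R n) A.

Definition affinely_independent (R : realType) n k
    (p : 'I_k.+1 -> 'rV[R]_n) : Prop :=
  free [seq p (lift ord0 i) - p ord0 | i <- enum 'I_k].

Definition has_affine_dim (R : realType) n k (A : set 'rV[R]_n) : Prop :=
  exists p : 'I_k.+1 -> 'rV[R]_n,
    affinely_independent p /\ affine_hull A = affine_hull (range p).

Definition relative_interior (R : realType) n (A : set 'rV[R]_n) :
    set 'rV[R]_n :=
  [set x | A x /\ within (affine_hull A) (nbhs x) A].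

(* The families [v] and [w] have m + 1 and d - m + 1 points (m <= d), and the
   simplices conv V and conv W have them as vertices, hence the affine
   independence. A set T of this form is a polytope, as it is the convex hull
   of finitely many points. *)
Definition has_type (R : realType) n d m (T : set 'rV[R]_n) : Prop :=
  has_affine_dim d T /\
  exists (v : 'I_m.+1 -> 'rV[R]_n) (w : 'I_(d - m).+1 -> 'rV[R]_n),
    let V := range v in
    let W := range w in
    [/\ V `&` W = set0,
        affinely_independent v,
        affinely_independent w,
        T = convex_hull (V `|` W) &
        exists x, [/\ convex_hull V `&` convex_hull W = [set x],
                      relative_interior (convex_hull V) x &
                      relative_interior (convex_hull W) x]].

Definition borel_rV (R : realType) n : measurableType _ :=
  g_sigma_algebraType (@open 'rV[R]_n).

(* The increments xi_1, ..., xi_N are [xi] at indices 0, ..., N - 1. *)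
Definition partial_sum dsp (Omega : measurableType dsp) (R : realType)
    (P : probability Omega R) d N (xi : 'I_N -> {RV P >-> borel_rV R d})
    (i : nat) (w : Omega) : 'rV[R]_d :=
  \sum_(j < N | (j < i)%N) (xi j w : 'rV[R]_d).

Definition walk_hull dsp (Omega : measurableType dsp) (R : realType)
    (P : probability Omega R) d N (xi : 'I_N -> {RV P >-> borel_rV R d})
    (w : Omega) : set 'rV[R]_d :=
  convex_hull [set partial_sum xi i w | i in [set i : nat | (i <= N)%N]].

(* Laws are compared on measurable sets only: `pushforward` is a total function
   on sets. The tuple type carries the product sigma-algebra of (R^d)^N. *)
Definition exchangeable dsp (Omega : measurableType dsp) (R : realType)
    (P : probability Omega R) d N (xi : 'I_N -> {RV P >-> borel_rV R d}) :
    Prop :=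
  forall (s : 'S_N) (B : set (N.-tuple (borel_rV R d))), measurable B ->
    pushforward P (fun w => [tuple xi (s i) w | i < N]) B =
    pushforward P (fun w => [tuple xi i w | i < N]) B.

Definition general_position dsp (Omega : measurableType dsp) (R : realType)
    (P : probability Omega R) d N (xi : 'I_N -> {RV P >-> borel_rV R d}) :
    Prop :=
  forall i : 'I_d -> nat, (forall k, (1 <= i k <= N)%N) ->
    {homo i : a b / (a < b)%N} ->
    P [set w | ~~ free [seq partial_sum xi (i k) w | k <- enum 'I_d]] = 0%E.

(* Main.v *)
Require Import Defs.
From mathcomp Require Import all_boot all_order all_algebra all_fingroup.
From mathcomp Require Import all_classical all_reals all_analysis measurable_realfun.
From mathcomp Require Import zify ring.

(** Let X be the (d+1) x d matrix of the increments. Its signed maximal minors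
    mu_1, ..., mu_(d+1) are the coefficients of a linear relation between the
    increments, unique up to scaling. Summation by parts turns it into the affine
    relation between S_0, ..., S_(d+1) whose coefficients are the differences
    l_i = mu_i - mu_(i+1), where mu_0 = mu_(d+2) = 0, and the signs of its
    coefficients (the Radon partition of the d + 2 points) determine the type of
    the convex hull: for generic increments it is T_m exactly when m + 1 of the
    l_i have the same sign, that is, when the cyclic sequence 0, mu_1, ...,
    mu_(d+1) has m + 1 cyclic ascents or m + 1 cyclic descents.

    Permuting the increments permutes mu, up to a common nonzero factor. By
    exchangeability the probability is thus the proportion of the permutations
    of d + 1 given distinct nonzero numbers with that many cyclic ascents or
    descents. The map x |-> -1/x makes 0 the point at infinity and preserves the
    cyclic order, so the number of cyclic ascents becomes one more than the
    number of ascents of a permutation of d + 1 numbers. *)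

Set Implicit Arguments.
Unset Strict Implicit.
Unset Printing Implicit Defensive.

Import Order.TTheory GRing.Theory Num.Theory.
Import numFieldNormedType.Exports.

Local Open Scope classical_set_scope.
Local Open Scope ring_scope.

(** * Cyclic ascents *)

Definition num_pos (R : realFieldType) (I : finType) (l : I -> R) : nat :=
  #|[set i | 0 < l i]%SET|.

Definition num_neg (R : realFieldType) (I : finType) (l : I -> R) : nat :=
  #|[set i | l i < 0]%SET|.

(* The sequence 0, a_0, ..., a_(n-1), 0, 0, ... *)
Definition bordered (R : realFieldType) n (a : 'I_n -> R) (k : nat) : R :=
  if k is k'.+1 then oapp a 0 (insub k') else 0.
Arguments bordered : simpl never.

(** Negative entries mark the ascents of the cycle 0, a_0, ..., a_(n-1), positive entries its
    descents. *)
Definition cdiff (R : realFieldType) n (a : 'I_n -> R) (i : 'I_n.+1) : R :=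
  bordered a i - bordered a i.+1.

Section CyclicAscents.
Variable R : realFieldType.

Lemma bordered_ord n (a : 'I_n -> R) (i : 'I_n) : bordered a i.+1 = a i.
Proof. by rewrite /bordered valK. Qed.

Lemma bordered_last n (a : 'I_n -> R) : bordered a n.+1 = 0.
Proof. by rewrite /bordered insubF // ltnn. Qed.

Lemma num_neg_sum (I : finType) (l : I -> R) :
  num_neg l = (\sum_i (l i < 0)%R)%N.
Proof. by rewrite /num_neg -sum1dep_card big_mkcond. Qed.

(** The map x |-> -1/x is increasing on each side of 0 but sends the positive numbers below the
    images of the negative ones. The two sign terms correct for this and telescope along a
    sequence. *)
Lemma ltr_Ninv (x y : R) : x != 0 -> y != 0 ->
  ((- x^-1 < - y^-1)%R + (0 < y)%R = (x < y)%R + (0 < x)%R)%N.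
Proof.
move=> x0 y0; rewrite ltrN2.
have [xp|xn|xz] := ltgtP 0 x; last by rewrite -xz eqxx in x0.
  have [yp|yn|yz] := ltgtP 0 y; last by rewrite -yz eqxx in y0.
    by rewrite ltf_pV2.
  rewrite (lt_trans (_ : y^-1 < 0) _) ?invr_gt0 ?invr_lt0 //.
  by rewrite ltNge (ltW (lt_trans yn xp)).
have [yp|yn|yz] := ltgtP 0 y; last by rewrite -yz eqxx in y0.
  rewrite (lt_trans xn yp) ltNge ltW //.
  by apply: lt_trans (_ : _ < 0) _; rewrite ?invr_gt0 ?invr_lt0.
by rewrite ltf_nV2.
Qed.

(* The map x |-> -1/x exchanges the positive and the negative numbers without
   changing the cyclic order of 0 and the nonzero numbers: it makes 0, as the
   point at infinity, the largest term of the cycle. *)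
Lemma cyclic_ascents_Ninv (b : nat -> R) n : (forall i, (i <= n)%N -> b i != 0) ->
  (\sum_(i < n) (b i < b i.+1)%R + (0 < b 0)%R + (b n < 0)%R =
   (\sum_(i < n) (- (b i)^-1 < - (b i.+1)^-1)%R).+1)%N.
Proof.
have sgn (y : R) : y != 0 -> ((0 < y)%R + (y < 0)%R = 1)%N by case: ltgtP.
elim: n => [|n IHn] b0; first by rewrite !big_ord0 add0n (sgn _ (b0 _ _)).
have := IHn (fun i (ni : (i <= n)%N) => b0 i (leqW ni)).
rewrite !big_ord_recr /=.
have := ltr_Ninv (b0 n (leqnSn n)) (b0 n.+1 (leqnn _)).
have := sgn _ (b0 n (leqnSn n)); have := sgn _ (b0 n.+1 (leqnn _)); lia.
Qed.

(** The first and last differences compare 0 with the end entries; they are the boundary terms of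
    [cyclic_ascents_Ninv]. *)
Lemma num_neg_cdiff n (a : 'I_n.+1 -> R) : (forall i, a i != 0) ->
  num_neg (cdiff a) =
  (\sum_(i < n) (- (a (inord i))^-1 < - (a (inord i.+1))^-1)%R).+1.
Proof.
move=> a0; rewrite num_neg_sum big_ord_recl big_ord_recr /=.
pose b i := a (inord i).
rewrite -(@cyclic_ascents_Ninv b) => [|i _]; last exact: a0.
have bE i : (i < n.+1)%N -> bordered a i.+1 = b i.
  by move=> ni; rewrite /b -(bordered_ord a (inord i)) inordK.
rewrite /cdiff !lift0 /= bordered_last bE // bE // /= sub0r oppr_lt0 subr0.
rewrite addnA; congr (_ + _)%N; rewrite addnC; congr (_ + _)%N.
by apply: eq_bigr => i _; rewrite !bE ?subr_lt0 //= ?ltnS /bump ?ltn_ord // ltnW.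
Qed.

Lemma card_ascents n (s : 'S_n.+1) :
  #|ascents s| = (\sum_(i < n) (s (inord i) < s (inord i.+1))%N)%N.
Proof.
rewrite -sum1_card big_mkcond big_ord_recl /= inE.
(* Index 0 has no predecessor, so it is never an ascent. *)
case: existsP => [[j /andP[/eqP //]]|_]; rewrite add0n.
apply: eq_bigr => i _; rewrite inE.
have -> : inord i.+1 = lift ord0 i :> 'I_n.+1.
  by apply/val_inj; rewrite /= inordK // ltnS.
have wi : inord i = widen_ord (leqnSn n) i :> 'I_n.+1.
  by apply/val_inj; rewrite /= inordK // ltnW // ltnS.
case: existsP => [[j /andP[/eqP ji lt_ji]]|h].
  suff -> : inord i = j by rewrite lt_ji.
  by apply/val_inj; rewrite wi /=; move: ji; rewrite /= /bump; lia.
case: ltnP => // lt_i; case: h; exists (inord i).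
by rewrite lt_i wi /= /bump add1n eqxx.
Qed.

(** The rank of [i] is the number of values below [g i]. *)
Lemma perm_of_rank n (g : 'I_n -> R) : injective g ->
  exists r : 'S_n, forall i j, (r i < r j)%N = (g i < g j).
Proof.
move=> g_inj; pose S i := [set k | g k < g i]%SET.
have SP i j : g i < g j -> (#|S i| < #|S j|)%N.
  move=> gij; apply: proper_card; apply/properP; split.
    by apply/fintype.subsetP => k; rewrite !inE => /lt_trans; apply.
  by exists i; rewrite !inE ?ltxx.
have SPE i j : (#|S i| < #|S j|)%N = (g i < g j).
  case: (ltgtP (g i) (g j)) => [/SP -> //|/SP/ltnW|/g_inj ->].
    by rewrite leqNgt => /negbTE.
  by rewrite ltnn.
have Sn i : (#|S i| < n)%N.
  rewrite -[X in (_ < X)%N]card_ord -cardsT; apply: proper_card.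
  by apply/properP; split; [exact: finset.subsetT|exists i; rewrite !inE ?ltxx].
have r_inj : injective (fun i => Ordinal (Sn i)).
  move=> i j [] Sij; apply: g_inj; apply/eqP.
  by rewrite eq_le !leNgt -!SPE Sij ltnn.
by exists (perm r_inj) => i j; rewrite !permE /= SPE.
Qed.

(** By [num_neg_cdiff] only the order of the values -1/a_i matters. With [r] their ranking, [a \o s]
    has one more cyclic ascent than [s * r] has ascents, and s |-> s r is a bijection. *)
Lemma card_num_neg_cdiff n (a : 'I_n.+1 -> R) m :
  injective a -> (forall i, a i != 0) ->
  #|[set s : 'S_n.+1 | num_neg (cdiff (a \o s)) == m.+1]%SET| = eulerian n.+1 m.
Proof.
move=> a_inj a0.
have g_inj : injective (fun i => - (a i)^-1) by move=> i j /oppr_inj/invr_inj/a_inj.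
have [r rP] := perm_of_rank g_inj.
rewrite /eulerian -!sum1dep_card [in RHS](reindex_inj (mulIg r)) /=.
apply: eq_bigl => s.
rewrite num_neg_cdiff => [|i]; last exact: a0.
rewrite eqSS card_ascents; congr (_ == _); apply: eq_bigr => i _.
by rewrite /= -rP -!permM.
Qed.

(** Reading the cycle backwards turns descents into ascents; position k of the bordered sequence
    becomes n + 1 - k. *)
Lemma num_pos_cdiff_rev n (a : 'I_n -> R) (s : 'S_n) :
  num_pos (cdiff (a \o s)) = num_neg (cdiff (a \o (perm rev_ord_inj * s)%g)).
Proof.
rewrite /num_pos /num_neg -(card_imset _ rev_ord_inj); apply: eq_card => i.
rewrite -[i in LHS]rev_ordK finset.mem_imset; last exact: rev_ord_inj.
rewrite !inE /cdiff subr_gt0 subr_lt0 /=.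
have E k : (k <= n)%N ->
    bordered (a \o (perm rev_ord_inj * s)%g) k = bordered (a \o s) (n.+1 - k).
  case: k => [|k] kn; first by rewrite subn0 bordered_last.
  have -> : (n.+1 - k.+1 = (rev_ord (Ordinal kn)).+1)%N by rewrite /=; lia.
  by rewrite (bordered_ord _ (Ordinal kn)) bordered_ord /= permM permE.
rewrite E; last by rewrite -ltnS.
have [ni|ni] := ltnP i n.
  by rewrite E // subSS -subSn // ltnW.
have -> : i = n :> nat by have := ltn_ord i; lia.
by rewrite subSS subnn bordered_last subSnn.
Qed.

Lemma card_num_pos_cdiff n (a : 'I_n.+1 -> R) m :
  injective a -> (forall i, a i != 0) ->
  #|[set s : 'S_n.+1 | num_pos (cdiff (a \o s)) == m.+1]%SET| = eulerian n.+1 m.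
Proof.
move=> a_inj a0; rewrite -(card_num_neg_cdiff m a_inj a0).
rewrite -!sum1dep_card [in RHS](reindex_inj (mulgI (perm (@rev_ord_inj n.+1)))).
by apply: eq_bigl => s; rewrite num_pos_cdiff_rev.
Qed.

End CyclicAscents.

(** * Convex and affine hulls of finite families *)

Section Hulls.
Variables (R : realType) (n : nat).
Implicit Types (A B : set 'rV[R]_n) (x y : 'rV[R]_n) (I J : finType).

Definition convex_weights I (c : I -> R) := (forall i, 0 <= c i) /\ \sum_i c i = 1.

Definition affine_relation I (p : I -> 'rV[R]_n) (c : I -> R) :=
  \sum_i c i = 0 /\ \sum_i c i *: p i = 0.

Lemma convex_setP A : convex_set A <->
  forall x y t, 0 <= t -> t <= 1 -> A x -> A y -> A (t *: x + (1 - t) *: y).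
Proof.
split=> [cA x y t t0 t1 Ax Ay|cA x y t /set_mem Ax /set_mem Ay].
  by have /set_mem := cA x y (Itv01 t0 t1) (mem_set Ax) (mem_set Ay).
by apply/mem_set; apply: cA.
Qed.

Lemma convex_hull_convex A : convex_set (convex_hull A).
Proof.
apply/convex_setP => x y t t0 t1 Ax Ay B [cB AB].
by move/convex_setP: (cB); apply=> //; [apply: Ax|apply: Ay].
Qed.

Lemma affine_hull_affine A : affine_set (affine_hull A).
Proof. by move=> x y t Ax Ay B [aB AB]; apply: (aB); [apply: Ax|apply: Ay]. Qed.

(** Induction on the list of points, with weights rescaled to total 1: a new point enters by a
    binary combination with weight c_i / (c_i + S). *)
Lemma convex_set_sum A I (p : I -> 'rV[R]_n) (c : I -> R) :
  convex_set A -> (forall i, A (p i)) -> convex_weights c ->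
  A (\sum_i c i *: p i).
Proof.
move=> /convex_setP cA Ap [c0 c1].
have main (s : seq I) : 0 < \sum_(i <- s) c i ->
    A ((\sum_(i <- s) c i)^-1 *: \sum_(i <- s) c i *: p i).
  elim: s => [|i s IHs]; first by rewrite big_nil ltxx.
  rewrite !big_cons; set S := \sum_(j <- s) c j in IHs *.
  set P := \sum_(j <- s) _ in IHs *.
  have S0 : 0 <= S by apply: sumr_ge0.
  (* A tail of total weight 0 cannot be rescaled, but all its weights vanish. *)
  have [SE|Sgt0] := eqVneq S 0.
    have -> : P = 0.
      rewrite /P big_seq big1 // => j js.
      suff -> : c j = 0 by rewrite scale0r.
      apply/le_anti; rewrite c0 -SE /S (big_rem j js) /= andbT.
      by rewrite lerDl sumr_ge0.
    rewrite SE !addr0 => ci; rewrite scalerA mulVf ?scale1r ?gt_eqF //.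
  have {}Sgt0 : 0 < S by rewrite lt_neqAle eq_sym Sgt0.
  move=> cS; pose t := c i / (c i + S).
  have -> : (c i + S)^-1 *: (c i *: p i + P) =
      t *: p i + (1 - t) *: (S^-1 *: P).
    rewrite scalerDr !scalerA [_^-1 * c i]mulrC; congr (_ + _ *: _).
    by rewrite /t; field; rewrite !gt_eqF.
  apply: cA => //; first by rewrite divr_ge0 // ltW.
    by rewrite /t ler_pdivrMr // mul1r lerDl.
  exact: IHs.
by have := main (index_enum I); rewrite c1 invr1 scale1r; apply.
Qed.

(** The vectors u with p_(i0) + u in A are closed under scaling and addition, so they include the
    combination of the differences p_i - p_(i0). *)
Lemma affine_set_sum A I (p : I -> 'rV[R]_n) (c : I -> R) :
  affine_set A -> (forall i, A (p i)) -> \sum_i c i = 1 ->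
  A (\sum_i c i *: p i).
Proof.
move=> aA Ap c1.
have [i0|I0] := pickP (@predT I); last first.
  by move: c1; rewrite big_pred0 // => /esym/eqP; rewrite oner_eq0.
move=> _; have scaleA u t : A (p i0 + u) -> A (p i0 + t *: u).
  move=> Au; have := aA _ _ t Au (Ap i0).
  by rewrite scalerDr scalerBl scale1r addrAC [t *: p i0 + _]addrC subrK.
(* The point p + (u + v) is the midpoint of p + 2u and p + 2v. *)
have addA' u v : A (p i0 + u) -> A (p i0 + v) -> A (p i0 + (u + v)).
  move=> Au Av; have := aA _ _ (2^-1) (scaleA _ 2 Au) (scaleA _ 2 Av).
  have -> : 1 - 2^-1 = 2^-1 :> R by field.
  by rewrite -scalerDr addrACA -!scalerDr -mulr2n -[p i0 *+ 2]scaler_nat -scalerDr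
    scalerA mulVf ?scale1r ?pnatr_eq0.
have -> : \sum_i c i *: p i = p i0 + \sum_i c i *: (p i - p i0).
  under [in RHS]eq_bigr do rewrite scalerBr.
  by rewrite sumrB -scaler_suml c1 scale1r addrC subrK.
apply: (big_ind (fun u => A (p i0 + u))) => [||i _]; first by rewrite addr0.
  exact: addA'.
by apply: scaleA; rewrite addrC subrK.
Qed.

Lemma convex_hull_rangeP I (p : I -> 'rV[R]_n) x :
  convex_hull (range p) x <->
  exists2 c, convex_weights c & x = \sum_i c i *: p i.
Proof.
split=> [|[c cw ->]]; last first.
  apply: convex_set_sum cw; first exact: convex_hull_convex.
  by move=> i B [_]; apply; exists i.
apply: (@smallest_sub _ _ _
  [set x | exists2 c, convex_weights c & x = \sum_i c i *: p i]).
- apply/convex_setP => _ _ t t0 t1 [a [a0 a1] ->] [b [b0 b1] ->].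
  exists (fun i => t * a i + (1 - t) * b i); first split.
  + by move=> i; rewrite addr_ge0 // mulr_ge0 // subr_ge0.
  + by rewrite big_split /= -!mulr_sumr a1 b1 !mulr1 addrC subrK.
  rewrite !scaler_sumr -big_split /=; apply: eq_bigr => i _.
  by rewrite !scalerA -scalerDl.
- move=> _ [i _ <-]; exists (fun j => (j == i)%:R); first split.
  + by move=> j; rewrite ler0n.
  + by rewrite (bigD1 i) //= eqxx big1 ?addr0 // => j /negbTE ->.
  rewrite (bigD1 i) //= eqxx scale1r big1 ?addr0 // => j /negbTE ->.
  by rewrite scale0r.
Qed.

Lemma affine_hull_rangeP I (p : I -> 'rV[R]_n) x :
  affine_hull (range p) x <->
  exists2 c, \sum_i c i = 1 & x = \sum_i c i *: p i.
Proof.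
split=> [|[c cw ->]]; last first.
  apply: affine_set_sum cw; first exact: affine_hull_affine.
  by move=> i B [_]; apply; exists i.
apply: (@smallest_sub _ _ _
  [set x | exists2 c, \sum_i c i = 1 & x = \sum_i c i *: p i]).
- move=> _ _ t [a a1 ->] [b b1 ->].
  exists (fun i => t * a i + (1 - t) * b i).
    by rewrite big_split /= -!mulr_sumr a1 b1 !mulr1 addrC subrK.
  rewrite !scaler_sumr -big_split /=; apply: eq_bigr => i _.
  by rewrite !scalerA -scalerDl.
- move=> _ [i _ <-]; exists (fun j => (j == i)%:R).
    by rewrite (bigD1 i) //= eqxx big1 ?addr0 // => j /negbTE ->.
  rewrite (bigD1 i) //= eqxx scale1r big1 ?addr0 // => j /negbTE ->.
  by rewrite scale0r.
Qed.

Lemma sub_convex_hull A : A `<=` convex_hull A.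
Proof. exact: sub_gen_smallest. Qed.

Lemma affine_hull_convex_hull A : affine_hull (convex_hull A) = affine_hull A.
Proof.
apply/seteqP; split; apply: smallest_sub; try exact: affine_hull_affine.
  apply: smallest_sub; last exact: sub_gen_smallest.
  by apply/convex_setP => x y t _ _ Ax Ay; apply: affine_hull_affine.
by move=> x Ax; apply: sub_gen_smallest; apply: sub_gen_smallest.
Qed.

Lemma affine_hullS A B : A `<=` B -> affine_hull A `<=` affine_hull B.
Proof.
move=> AB; apply: smallest_sub; first exact: affine_hull_affine.
by move=> x /AB Bx; apply: sub_gen_smallest.
Qed.

Lemma convex_hull_subset A B : convex_hull A `<=` convex_hull B <->
  A `<=` convex_hull B.
Proof.
split=> [AB x Ax|AB]; first by apply: AB; apply: sub_gen_smallest.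
by apply: smallest_sub => //; exact: convex_hull_convex.
Qed.

Lemma affinely_independentP k (p : 'I_k.+1 -> 'rV[R]_n) :
  affinely_independent p <->
  forall c, affine_relation p c -> forall i, c i = 0.
Proof.
rewrite /affinely_independent.
have -> : free [seq p (lift ord0 i) - p ord0 | i <- enum 'I_k] =
    free [tuple p (lift ord0 i) - p ord0 | i < k] by [].
split=> [/freeP p_free c [c0 cp] i|p_ind].
  have cl j : c (lift ord0 j) = 0.
    apply: (p_free (fun j => c (lift ord0 j))).
    under eq_bigr do rewrite -tnth_nth tnth_mktuple scalerBr.
    rewrite sumrB -scaler_suml; move: c0 cp; rewrite !big_ord_recl => /eqP.
    by rewrite addrC addr_eq0 => /eqP ->; rewrite scaleNr opprK addrC.
  have [j ->|->] := unliftP ord0 i; first exact: cl.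
  by move: c0; rewrite big_ord_recl big1 ?addr0.
apply/freeP => u u0 j.
(* The coefficient of the base point is forced by the zero sum. *)
have := p_ind (fun i => oapp u (- \sum_j u j) (unlift ord0 i)) _ (lift ord0 j).
rewrite liftK; apply; split; rewrite big_ord_recl unlift_none /=.
  by under [X in _ + X]eq_bigr do rewrite liftK /=; rewrite addNr.
rewrite -[RHS]u0; under [X in _ + X]eq_bigr do rewrite liftK /=.
under [in RHS]eq_bigr do rewrite -tnth_nth tnth_mktuple scalerBr.
by rewrite sumrB -scaler_suml scaleNr addrC.
Qed.

(** Homogeneous coordinates: the appended 1 turns affine relations between the points into linear
    relations between the rows. *)
Definition homog k (p : 'I_k -> 'rV[R]_n) : 'M[R]_(k, n + 1) :=
  row_mx (\matrix_i p i) (const_mx 1).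

Lemma mul_homog k (p : 'I_k -> 'rV[R]_n) (c : 'rV[R]_k) :
  c *m homog p = row_mx (\sum_i c 0 i *: p i) (\sum_i c 0 i)%:M.
Proof.
rewrite mul_mx_row; congr row_mx.
  by rewrite mulmx_sum_row; apply: eq_bigr => i _; rewrite rowK.
apply/rowP => j; rewrite !mxE (ord1 j) eqxx mulr1n.
by apply: eq_bigr => i _; rewrite mxE mulr1.
Qed.

Lemma row_free_homog k (p : 'I_k.+1 -> 'rV[R]_n) :
  affinely_independent p -> row_free (homog p).
Proof.
move=> /affinely_independentP p_ind; apply: inj_row_free => v.
rewrite mul_homog -row_mx0 => /eq_row_mx [vp /matrixP/(_ 0 0)].
rewrite !mxE eqxx mulr1n => v1; apply/rowP => i; rewrite mxE.
exact: (p_ind (v 0)).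
Qed.

(** The n + 1 independent homogeneous rows span R^(n+1). The coordinates of (x, 1) are weights for
    x, and the last column makes their sum 1. *)
Lemma affine_hull_full (p : 'I_n.+1 -> 'rV[R]_n) :
  affinely_independent p -> affine_hull (range p) = setT.
Proof.
move=> /row_free_homog p_free; apply/seteqP; split=> // x _.
have /submxP[c] : (row_mx x 1%:M <= homog p)%MS.
  by apply: submx_full; rewrite -col_leq_rank (eqP p_free) addn1.
rewrite mul_homog => /eq_row_mx [-> /matrixP/(_ 0 0)].
rewrite !mxE eqxx !mulr1n => c1.
by apply/affine_hull_rangeP; exists (c 0).
Qed.

Lemma has_affine_dim_full A : has_affine_dim n A -> affine_hull A = setT.
Proof. by move=> [p [p_ind ->]]; exact: affine_hull_full. Qed.

Lemma has_affine_dim_range I (p : I -> 'rV[R]_n) (h : 'I_n.+1 -> I) :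
  affinely_independent (p \o h) -> has_affine_dim n (convex_hull (range p)).
Proof.
move=> ph_ind; exists (p \o h); split=> //.
rewrite affine_hull_convex_hull (affine_hull_full ph_ind).
apply/seteqP; split=> // x _.
have : affine_hull (range (p \o h)) x by rewrite affine_hull_full.
by apply: affine_hullS => _ [i _ <-]; exists (h i).
Qed.

(** Barycentric coordinates extend to continuous functions on the whole space, so they stay positive
    near the point; within the affine hull, nonnegative coordinates mean membership in the
    simplex. *)
Lemma relative_interior_simplex k (v : 'I_k.+1 -> 'rV[R]_n) (a : 'I_k.+1 -> R) :
  affinely_independent v -> (forall i, 0 < a i) -> \sum_i a i = 1 ->
  relative_interior (convex_hull (range v)) (\sum_i a i *: v i).
Proof.
move=> v_ind a0 a1; split.
  by apply/convex_hull_rangeP; exists a => //; split=> // i; exact: ltW.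
rewrite affine_hull_convex_hull.
pose B := pinvmx (homog v).
(* The barycentric coordinates, as affine functions on the whole space. *)
pose f i (y : 'rV[R]_n) := (y *m usubmx B) 0 i + (dsubmx B) 0 i.
have fE (c : 'I_k.+1 -> R) i : \sum_j c j = 1 -> f i (\sum_j c j *: v j) = c i.
  move=> c1; transitivity ((row_mx (\sum_j c j *: v j) 1%:M *m B) 0 i).
    rewrite -[in RHS](vsubmxK B) mul_row_col mul1mx.
    by rewrite [RHS]mxE.
  have := mul_homog v (\row_j c j).
  under eq_bigr do rewrite mxE.
  under [X in X%:M]eq_bigr do rewrite mxE.
  by rewrite c1 => <-; rewrite mulmxKp ?row_free_homog // mxE.
have f_cont i (y0 : 'rV[R]_n) : f i y @[y --> y0] --> f i y0.
  apply: (@cvgD _ _ _ _ (nbhs_filter y0)).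
    rewrite mxE; under eq_cvg do rewrite mxE.
    apply: (@cvg_big _ _ _ _ _ add_continuous _ _ _ _ _ (nbhs_filter y0)) => j _.
    by apply: (@cvgMr_tmp _ _ _ (nbhs_filter y0)); exact: coord_continuous.
  exact: (@cvg_cst _ _ _ _ (nbhs_filter y0)).
have : \forall y \near nbhs (\sum_i a i *: v i), forall i, 0 < f i y.
  apply: (@filter_forall _ _ _ _ (nbhs_filter _)) => i.
  have := f_cont i (\sum_j a j *: v j); rewrite fE //.
  by move=> /(_ [set t | 0 < t]); apply; exact: lt_nbhsr.
apply: filterS => y fy0 /affine_hull_rangeP [c c1 yE].
apply/convex_hull_rangeP; exists c => //; split=> // i.
by have := fy0 i; rewrite yE fE // => /ltW.
Qed.

(** The point x can be pushed slightly away from the barycentre b inside the hull, to y = x + t (x -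
    b). Then x = (y + t b) / (1 + t), where b gives every vertex a positive weight. *)
Lemma relative_interior_weights k (v : 'I_k.+1 -> 'rV[R]_n) x :
  relative_interior (convex_hull (range v)) x ->
  exists a, [/\ forall i, 0 < a i, \sum_i a i = 1 & x = \sum_i a i *: v i].
Proof.
move=> [/convex_hull_rangeP[a [a0 a1] xE]]; rewrite affine_hull_convex_hull => xnbhs.
pose e : R := k.+1%:R^-1.
have e0 : 0 < e by rewrite invr_gt0 ltr0n.
have e1 : \sum_(i < k.+1) e = 1.
  by rewrite sumr_const card_ord -mulr_natl mulfV // pnatr_eq0.
pose b := \sum_i e *: v i.
pose y (t : R) := x + t *: (x - b).
have y_aff t : affine_hull (range v) (y t).
  apply/affine_hull_rangeP; exists (fun i => a i + t * (a i - e)).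
    by rewrite big_split /= -mulr_sumr sumrB a1 e1 subrr mulr0 addr0.
  rewrite /y xE /b -sumrB scaler_sumr -big_split /=; apply: eq_bigr => i _.
  by rewrite -scalerBl scalerA -scalerDl.
have y_cont : y t @[t --> (0 : R)] --> x.
  rewrite -[X in _ --> X]addr0 -[X in _ + X](scale0r (x - b)).
  by apply: cvgD; [exact: cvg_cst|apply: cvgZr_tmp; exact: cvg_id].
have [t t0 yt] : exists2 t : R, 0 < t & convex_hull (range v) (y t).
  have /nbhs_ballP[r /= r0 rP] := y_cont _ xnbhs.
  exists (r / 2); first by rewrite divr_gt0.
  apply: rP (y_aff _); rewrite /ball /= sub0r normrN gtr0_norm ?divr_gt0 //.
  by rewrite ltr_pdivrMr // ltr_pMr // ltr1n.
move/convex_hull_rangeP: yt => [c [c0 c1] yE].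
have t1 : 0 < 1 + t by rewrite addr_gt0.
exists (fun i => (c i + t * e) / (1 + t)); split.
- by move=> i; rewrite divr_gt0 // ltr_wpDl // mulr_gt0.
- by rewrite -mulr_suml big_split /= -mulr_sumr c1 e1 mulr1 divff ?gt_eqF.
transitivity ((1 + t)^-1 *: (y t + t *: b)).
  rewrite /y scalerBr addrA subrK -{2}[x]scale1r -scalerDl scalerA mulVf.
    by rewrite scale1r.
  by rewrite gt_eqF.
rewrite yE /b scaler_sumr -big_split /= scaler_sumr; apply: eq_bigr => i _.
by rewrite scalerA -scalerDl scalerA mulrC.
Qed.

(* Write u_k as a convex combination of the p_i, and each p_i as one of the u_l.
   In the resulting combination of the u_l the weight of u_k is 1, since u_k is
   extreme; so some p_i has weight 1 at u_k. *)
Lemma extreme_point_range I J (p : I -> 'rV[R]_n) (u : J -> 'rV[R]_n) k :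
  convex_hull (range p) = convex_hull (range u) ->
  (forall c, convex_weights c -> c k = 0 -> u k <> \sum_l c l *: u l) ->
  exists i, p i = u k.
Proof.
move=> pu k_ext.
have /convex_hull_rangeP[a [a0 a1] ukE] : convex_hull (range p) (u k).
  by rewrite pu; apply: sub_gen_smallest; exists k.
have pP i : exists M, convex_weights M /\ p i = \sum_l M l *: u l.
  have /convex_hull_rangeP[M Mw piE] : convex_hull (range u) (p i).
    by rewrite -pu; apply: sub_gen_smallest; exists i.
  by exists M.
have /choice[M MP] := pP.
pose c l := \sum_i a i * M i l.
have M1 i : M i k <= 1.
  have [[M0 <-] _] := MP i; rewrite (bigD1 k) //= lerDl.
  by apply: sumr_ge0 => l _.
have cM : 1 - c k = \sum_i a i * (1 - M i k).
  by under eq_bigr do rewrite mulrBr mulr1; rewrite sumrB a1.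
have aM0 i : 0 <= a i * (1 - M i k) by rewrite mulr_ge0 // subr_ge0.
have ck1 : 0 <= 1 - c k by rewrite cM sumr_ge0.
have c0 l : 0 <= c l.
  by apply: sumr_ge0 => i _; rewrite mulr_ge0 //; have [[]] := MP i.
have c1 : \sum_l c l = 1.
  rewrite exchange_big -[RHS]a1; apply: eq_bigr => i _ /=.
  by rewrite -mulr_sumr; have [[_ ->] _] := MP i; rewrite mulr1.
have ukc : u k = \sum_l c l *: u l.
  rewrite ukE; under eq_bigr do rewrite (MP _).2 scaler_sumr.
  rewrite exchange_big; apply: eq_bigr => l _ /=.
  by rewrite scaler_suml; apply: eq_bigr => i _; rewrite scalerA.
(* A total weight 1 at [k] forces [M i k = 1] wherever [a i] is nonzero. *)
have [ck|ck] := eqVneq (c k) 1.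
  have [i ai] : exists i, a i != 0.
    apply/existsP; apply: contraPT a1; rewrite negb_exists => /forallP a00.
    rewrite big1 => [/esym/eqP|i _]; first by rewrite oner_eq0.
    by apply/eqP; move: (a00 i); rewrite negbK.
  have Mi : M i k = 1.
    move/eqP: cM; rewrite ck subrr eq_sym => /eqP/psumr_eq0P/(_ i isT).
    move=> /(_ (fun i _ => aM0 i))/eqP; rewrite mulf_eq0 (negbTE ai) subr_eq0.
    by move/eqP => <-.
  exists i; have [[M0 M1i] ->] := MP i.
  rewrite (bigD1 k) //= Mi scale1r big1 ?addr0 // => l lk.
  suff -> : M i l = 0 by rewrite scale0r.
  apply/le_anti; rewrite M0 andbT.
  move: M1i; rewrite (bigD1 k) //= Mi => /eqP.
  rewrite -[X in _ == X]addr0 (inj_eq (addrI 1)) (bigD1 l) //= => /eqP h.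
  by rewrite -h lerDl sumr_ge0.
have ck0 : 0 < 1 - c k by rewrite lt_neqAle ck1 eq_sym subr_eq0 eq_sym ck.
(* Otherwise, moving the term of [u k] to the left and dividing by 1 - c_k writes [u k] with weight
   0 at [k]. *)
case: (k_ext (fun l => if l == k then 0 else c l / (1 - c k))).
- split.
    by move=> l; case: eqP => // _; rewrite divr_ge0 // ltW.
  rewrite (bigD1 k) //= eqxx add0r.
  under eq_bigr => l lk do rewrite (negbTE lk).
  rewrite -mulr_suml; move: c1; rewrite (bigD1 k) //= => /eqP.
  by rewrite addrC eq_sym -subr_eq => /eqP <-; rewrite divff ?gt_eqF.
- by rewrite eqxx.
rewrite (bigD1 k) //= eqxx scale0r add0r.
under eq_bigr => l lk do rewrite (negbTE lk) mulrC -scalerA.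
rewrite -scaler_sumr; move: ukc; rewrite (bigD1 k) //= => /eqP.
rewrite addrC -subr_eq => /eqP <-.
by rewrite -{2}[u k]scale1r -scalerBl scalerA mulVf ?scale1r ?gt_eqF.
Qed.

End Hulls.

(** * The type of the convex hull of d + 2 points *)

Section SignPattern.
Variable R : realFieldType.

Lemma num_posZ (I : finType) (l l' : I -> R) t :
  0 < t -> (forall i, l' i = t * l i) -> num_pos l' = num_pos l.
Proof. by move=> t0 E; apply: eq_card => i; rewrite !inE E pmulr_rgt0. Qed.

Lemma num_negZ (I : finType) (l l' : I -> R) t :
  0 < t -> (forall i, l' i = t * l i) -> num_neg l' = num_neg l.
Proof. by move=> t0 E; apply: eq_card => i; rewrite !inE E pmulr_rlt0. Qed.

Lemma num_posN (I : finType) (l l' : I -> R) t :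
  t < 0 -> (forall i, l' i = t * l i) -> num_pos l' = num_neg l.
Proof. by move=> t0 E; apply: eq_card => i; rewrite !inE E nmulr_rgt0. Qed.

Lemma num_negN (I : finType) (l l' : I -> R) t :
  t < 0 -> (forall i, l' i = t * l i) -> num_neg l' = num_pos l.
Proof. by move=> t0 E; apply: eq_card => i; rewrite !inE E nmulr_rlt0. Qed.

(* For m = 0 the coefficients need not all be nonzero: one point may lie on
   the boundary of the simplex spanned by the others. *)
Definition sign_pattern d m (l : 'I_d.+2 -> R) : bool :=
  if m is 0 then (num_pos l == 1) || (num_neg l == 1)
  else (num_pos l == m.+1) && (num_neg l == (d - m).+1)
    || (num_pos l == (d - m).+1) && (num_neg l == m.+1).

(** A negative factor exchanges the two counts, in which the pattern is symmetric. Relations are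
    only determined up to such a factor. *)
Lemma sign_patternZ d m (l l' : 'I_d.+2 -> R) t :
  t != 0 -> (forall i, l' i = t * l i) -> sign_pattern m l' = sign_pattern m l.
Proof.
rewrite neq_lt => /orP[] t0 E.
  by rewrite /sign_pattern (num_posN t0 E) (num_negN t0 E); case: m => [|m];
    rewrite orbC // ![(num_neg l == _) && _]andbC.
by rewrite /sign_pattern (num_posZ t0 E) (num_negZ t0 E).
Qed.

End SignPattern.

(** * Radon partitions and types *)

Section Types.
Variables (R : realType) (d : nat).

(** The relations form a space of dimension at most 1. That [l] is itself a relation is a separate
    condition. *)
Definition spans_relations (I : finType) (p : I -> 'rV[R]_d) (l : I -> R) :=
  forall c, affine_relation p c -> exists t, forall i, c i = t * l i.

Lemma affine_relation_point (I : finType) (p : I -> 'rV[R]_d) (c : I -> R) k :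
  \sum_i c i = 1 -> p k = \sum_i c i *: p i ->
  affine_relation p (fun i => (i == k)%:R - c i).
Proof.
move=> c1 pk; split.
  rewrite sumrB c1 (bigD1 k) //= eqxx big1 ?addr0 ?subrr // => i /negbTE -> //.
under eq_bigr do rewrite scalerBl.
rewrite sumrB -pk (bigD1 k) //= eqxx scale1r big1 ?addr0 ?subrr // => i /negbTE ->.
by rewrite scale0r.
Qed.

Lemma affine_relationN (I : finType) (p : I -> 'rV[R]_d) (c : I -> R) :
  affine_relation p c -> affine_relation p (fun i => - c i).
Proof.
move=> [c0 cp]; split; first by rewrite sumrN c0 oppr0.
by under eq_bigr do rewrite scaleNr; rewrite sumrN cp oppr0.
Qed.

Lemma spans_relationsN (I : finType) (p : I -> 'rV[R]_d) (l : I -> R) :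
  spans_relations p l -> spans_relations p (fun i => - l i).
Proof.
move=> span c /span[t ct]; exists (- t) => i.
by rewrite ct mulrN mulNr opprK.
Qed.

(** A relation avoiding [i0], extended by 0, is a multiple of [l] that vanishes at [i0], hence
    zero. *)
Lemma affinely_independent_lift (p : 'I_d.+2 -> 'rV[R]_d) l i0 :
  spans_relations p l -> l i0 != 0 -> affinely_independent (p \o lift i0).
Proof.
move=> span li0; apply/affinely_independentP => c [c0 cp] i.
have [|t ct] := span (fun k => oapp c 0 (unlift i0 k)).
  split; rewrite (bigD1_ord i0) //= unlift_none /= ?scale0r add0r.
    by rewrite -[RHS]c0; apply: eq_bigr => j _; rewrite liftK.
  by rewrite -[RHS]cp; apply: eq_bigr => j _; rewrite liftK.
have t0 : t = 0.
  have := ct i0; rewrite unlift_none /= => /esym/eqP.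
  by rewrite mulf_eq0 (negbTE li0) orbF => /eqP.
by have := ct (lift i0 i); rewrite liftK /= t0 mul0r.
Qed.

Lemma other_ord k (i : 'I_k.+1) : (0 < k)%N -> exists j, j != i.
Proof. by case: k i => // k i _; exists (lift i ord0); rewrite eq_sym neq_lift. Qed.

(** Radon's construction: the two sign parts of the relation, normalised, are weights of the common
    point. Uniqueness of the relation gives the independence of each family and the uniqueness of
    the point. *)
Lemma has_type_sum m (u : 'I_m.+1 + 'I_(d - m).+1 -> 'rV[R]_d) k :
  (0 < d)%N -> affine_relation u k -> spans_relations u k ->
  (forall i, 0 < k (inl i)) -> (forall j, k (inr j) < 0) ->
  has_affine_dim d (convex_hull (range u)) ->
  has_type d m (convex_hull (range u)).
Proof.
move=> d0 [k0 ku] span kl kr dimT; split=> //.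
pose v i := u (inl i); pose w j := u (inr j).
exists v, w => /=.
pose s := \sum_i k (inl i).
have s0 : 0 < s.
  by rewrite /s big_ord_recl ltr_pwDl // sumr_ge0 // => i _; exact: ltW.
have sr : \sum_j k (inr j) = - s.
  apply/eqP; rewrite -addr_eq0 addrC -[s + _]/(\sum_i _ + _).
  by rewrite -(big_sumType _ predT) k0.
pose a i := k (inl i) / s; pose b j := - k (inr j) / s.
have a0 i : 0 < a i by rewrite divr_gt0.
have b0 j : 0 < b j by rewrite divr_gt0 // oppr_gt0.
have a1 : \sum_i a i = 1 by rewrite -mulr_suml divff // gt_eqF.
have b1 : \sum_j b j = 1 by rewrite -mulr_suml sumrN sr opprK divff // gt_eqF.
have ab : \sum_i a i *: v i = \sum_j b j *: w j.
  apply: (scalerI (lt0r_neq0 s0)); apply/eqP.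
  rewrite -subr_eq0 !scaler_sumr; apply/eqP.
  rewrite -[RHS]ku big_sumType /= -sumrN; congr (_ + _); apply: eq_bigr => i _.
    by rewrite scalerA /a mulrC divfK // gt_eqF.
  by rewrite scalerA /b mulrC divfK ?gt_eqF // scaleNr opprK.
(* Every relation is a multiple of the normalised one, (a, -b). *)
have K al be : \sum_i al i + \sum_j be j = 0 ->
    \sum_i al i *: v i + \sum_j be j *: w j = 0 ->
    exists t, (forall i, al i = t * a i) /\ (forall j, be j = - (t * b j)).
  move=> ab0 abu; pose c x := match x with inl i => al i | inr j => be j end.
  have [|t ct] := span c; first by split; rewrite big_sumType.
  have ss : s != 0 by rewrite gt_eqF.
  exists (t * s); split=> [i|j]; first by have /= -> := ct (inl i); rewrite /a; field.
  by have /= -> := ct (inr j); rewrite /b; field.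
have t0 (t x : R) : 0 = t * x -> 0 < x -> t = 0.
  by move=> /esym/eqP; rewrite mulf_eq0 => /orP[/eqP //|/eqP ->]; rewrite ltxx.
have v_ind : affinely_independent v.
  apply/affinely_independentP => c [c0 cv] i.
  have [||t [ct c't]] := K c (fun=> 0).
  - by rewrite c0 big1 // addr0.
  - by rewrite cv big1 ?addr0 // => j _; rewrite scale0r.
  by rewrite ct (t0 t (b ord0)) ?mul0r // -[RHS]opprK -c't oppr0.
have w_ind : affinely_independent w.
  apply/affinely_independentP => c [c0 cw] i.
  have [||t [c't ct]] := K (fun=> 0) c.
  - by rewrite c0 big1 // addr0.
  - by rewrite cw big1 ?addr0 // => j _; rewrite scale0r.
  by rewrite ct (t0 t (a ord0)) ?mul0r ?oppr0.
split=> //.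
- rewrite -subset0 => _ [[i _ <-] [j _ wv]] /=.
  (* A coincidence v_i = w_j would be a relation supported on two indices. As d > 0, one of the
     families has a further index, where a or b is positive; hence t = 0. *)
  have [||t [at_ bt]] := K (fun x => (x == i)%:R) (fun x => - (x == j)%:R).
  + rewrite sumrN (bigD1 i) //= (bigD1 j) //= !eqxx.
    by rewrite !big1 ?addr0 ?subrr // => x /negbTE ->.
  + rewrite (bigD1 i) //= (bigD1 j) //= !eqxx !big1 ?addr0.
    * by rewrite scaleNr !scale1r wv subrr.
    * by move=> x /negbTE ->; rewrite oppr0 scale0r.
    * by move=> x /negbTE ->; rewrite scale0r.
  suff tz : t = 0.
    by have := at_ i; rewrite eqxx tz mul0r => /eqP; rewrite oner_eq0.
  have [m0|m0] := posnP m.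
    have [|j' j'j] := @other_ord (d - m) j; first by rewrite m0 subn0.
    apply: (t0 t (b j')) => //.
    have := bt j'; rewrite (negbTE j'j) oppr0 => /eqP.
    by rewrite eq_sym oppr_eq0 => /eqP.
  have [i' i'i] := other_ord i m0.
  by apply: (t0 t (a i')) => //; have := at_ i'; rewrite (negbTE i'i).
- congr convex_hull; apply/seteqP; split=> [_ [[i|j] _ <-]|_ [[i _ <-]|[j _ <-]]].
  + by left; exists i.
  + by right; exists j.
  + by exists (inl i).
  + by exists (inr j).
- exists (\sum_i a i *: v i); split.
  + apply/seteqP; split=> [y [/convex_hull_rangeP[al [_ al1] yv]]|_ -> /=].
      move=> /convex_hull_rangeP[be [_ be1] yw] /=.
      (* Two expressions of the same point differ by a relation, and the total weight 1 fixes its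
         factor. *)
      have [||t [alt_ _]] := K al (fun j => - be j).
      * by rewrite sumrN al1 be1 subrr.
      * by under [X in _ + X]eq_bigr do rewrite scaleNr; rewrite sumrN -yv -yw subrr.
      have t1 : t = 1.
        by rewrite -al1; under eq_bigr do rewrite alt_; rewrite -mulr_sumr a1 mulr1.
      by rewrite yv; apply: eq_bigr => i _; rewrite alt_ t1 mul1r.
    split; first by apply/convex_hull_rangeP; exists a => //; split=> // i; exact: ltW.
    by rewrite ab; apply/convex_hull_rangeP; exists b => //; split=> // i; exact: ltW.
  + exact: relative_interior_simplex.
  + by rewrite ab; exact: relative_interior_simplex.
Qed.

(** The counts add up to d + 2, so no coefficient vanishes and the two sign classes enumerate all
    the points. *)
Lemma has_type_of_counts m (p : 'I_d.+2 -> 'rV[R]_d) l :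
  (0 < d)%N -> (m <= d)%N -> affine_relation p l -> spans_relations p l ->
  num_pos l = m.+1 -> num_neg l = (d - m).+1 ->
  has_type d m (convex_hull (range p)).
Proof.
move=> d0 md [l0 lp] span posl negl.
pose h (x : 'I_m.+1 + 'I_(d - m).+1) : 'I_d.+2 :=
  match x with
  | inl i => enum_val (cast_ord (esym posl) i)
  | inr j => enum_val (cast_ord (esym negl) j)
  end.
have hl i : 0 < l (h (inl i)).
  by have := enum_valP (cast_ord (esym posl) i); rewrite inE.
have hr j : l (h (inr j)) < 0.
  by have := enum_valP (cast_ord (esym negl) j); rewrite inE.
have h_inj : injective h.
  move=> [i|j] [i'|j'] hh.
  - by congr inl; apply: (@cast_ord_inj _ _ (esym posl)); apply: enum_val_inj.
  - by have := hl i; rewrite hh ltNge (ltW (hr _)).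
  - by have := hl i'; rewrite -hh ltNge (ltW (hr _)).
  - by congr inr; apply: (@cast_ord_inj _ _ (esym negl)); apply: enum_val_inj.
have h_bij : bijective h.
  by apply: (inj_card_bij h_inj); rewrite card_sum !card_ord; lia.
have [g hK gK] := h_bij.
have ER : range p = range (p \o h).
  by apply/seteqP; split=> _ [i _ <-]; [exists (g i); rewrite //= gK|exists (h i)].
rewrite ER; apply: (@has_type_sum _ _ (l \o h)) => //.
- split; first by rewrite -[RHS]l0 (reindex h) //; exact: onW_bij.
  by rewrite -[RHS]lp (reindex h) //; exact: onW_bij.
- move=> c [c0 cp]; have [|t ct] := span (c \o g).
    split; rewrite (reindex h) /=; try exact: onW_bij.
      by under eq_bigr do rewrite hK.
    by under eq_bigr do rewrite hK.
  by exists t => x; rewrite -(ct (h x)) /= hK.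
rewrite -ER; apply: (@has_affine_dim_range _ _ _ _ (lift (h (inl ord0)))).
by apply: (affinely_independent_lift span); rewrite gt_eqF.
Qed.

(** The point p_(i0) lies in the simplex of the others but possibly on its boundary, whereas the
    type asks for a point of the relative interior. The hull is that simplex, so p_(i0) can be
    replaced by the barycentre b. *)
Lemma has_type0_of_count (p : 'I_d.+2 -> 'rV[R]_d) l :
  (0 < d)%N -> affine_relation p l -> spans_relations p l ->
  num_pos l = 1%N -> has_type d 0 (convex_hull (range p)).
Proof.
move=> d0 [l0 lp] span posl.
have /eqP/cards1P[i0 lE] : #|[set i | 0 < l i]%SET| = 1%N by [].
have li0 : 0 < l i0 by have := set11 i0; rewrite -lE inE.
have lneg i : i != i0 -> l i <= 0.
  move=> ii0; rewrite leNgt; apply/negP => li.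
  have : i \in [set i | 0 < l i]%SET by rewrite inE.
  by rewrite lE inE (negbTE ii0).
have q_ind : affinely_independent (p \o lift i0).
  by apply: (affinely_independent_lift span); rewrite gt_eqF.
have dimT := has_affine_dim_range q_ind.
pose e : R := d.+1%:R^-1.
have e0 : 0 < e by rewrite invr_gt0 ltr0n.
have e1 : \sum_(i < d.+1) e = 1.
  by rewrite sumr_const card_ord -mulr_natl mulfV // pnatr_eq0.
pose b := \sum_(i < d.+1) e *: p (lift i0 i).
have bW : convex_hull (range (p \o lift i0)) b.
  by apply/convex_hull_rangeP; exists (fun=> e) => //; split=> // i; exact: ltW.
have pW : convex_hull (range (p \o lift i0)) (p i0).
  apply/convex_hull_rangeP; exists (fun j => - l (lift i0 j) / l i0).
    split=> [j|].
      by rewrite divr_ge0 ?(ltW li0) // oppr_ge0 lneg // eq_sym neq_lift.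
    rewrite -mulr_suml sumrN.
    have /eqP := l0; rewrite (bigD1_ord i0) //= addrC addr_eq0 => /eqP ->.
    by rewrite opprK divff // gt_eqF.
  apply: (scalerI (lt0r_neq0 li0)); rewrite scaler_sumr.
  have /eqP := lp; rewrite (bigD1_ord i0) //= addr_eq0 => /eqP ->.
  rewrite -sumrN; apply: eq_bigr => j _.
  by rewrite scalerA mulrC divfK ?gt_eqF // scaleNr.
(* The casts reconcile [d - 0], from the definition of the type, with [d]. *)
pose u (x : 'I_1 + 'I_(d - 0).+1) :=
  match x with inl _ => b | inr j => p (lift i0 (cast_ord (congr1 S (subn0 d)) j)) end.
have ER : convex_hull (range p) = convex_hull (range u).
  have qu j : range u (p (lift i0 j)).
    exists (inr (cast_ord (esym (congr1 S (subn0 d))) j)) => //=.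
    by rewrite cast_ordKV.
  have -> : convex_hull (range p) = convex_hull (range (p \o lift i0)).
    apply/seteqP; split; apply/convex_hull_subset => _ [i _ <-].
      have [j ->|->] := unliftP i0 i; last exact: pW.
      by apply: sub_convex_hull; exists j.
    by apply: sub_convex_hull; exists (lift i0 i).
  apply/seteqP; split; apply/convex_hull_subset => _ [i _ <-].
    by apply: sub_convex_hull; exact: qu.
  case: i => [i|j] /=; first exact: bW.
  by apply: sub_convex_hull; exists (cast_ord (congr1 S (subn0 d)) j).
have sumE (V : nmodType) (F : 'I_(d - 0).+1 -> V) :
    \sum_j F j = \sum_j F (cast_ord (esym (congr1 S (subn0 d))) j).
  apply: reindex; apply: onW_bij; exists (cast_ord (congr1 S (subn0 d))) => j.
    exact: cast_ordKV.
  exact: cast_ordK.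
rewrite ER; rewrite ER in dimT.
apply: (@has_type_sum _ _ (fun x => match x with inl _ => 1 | inr _ => - e end)) => //.
- split; rewrite big_sumType /= big_ord1 sumE.
    by rewrite sumrN e1 subrr.
  under [X in _ + X]eq_bigr do rewrite cast_ordKV scaleNr.
  by rewrite sumrN scale1r subrr.
- move=> c [c0 cu]; exists (c (inl ord0)).
  (* Subtracting a multiple of the barycentre relation leaves a relation between the vertices alone,
     which is trivial. *)
  have cr j : c (inr (cast_ord (esym (congr1 S (subn0 d))) j)) = - (c (inl ord0) * e).
    move/affinely_independentP: q_ind => /(_ (fun j =>
       c (inr (cast_ord (esym (congr1 S (subn0 d))) j)) + c (inl ord0) * e)) q_ind.
    apply/eqP; rewrite -addr_eq0; apply/eqP; apply: q_ind; split.
      rewrite big_split /= -mulr_sumr e1 mulr1 addrC -[RHS]c0 big_sumType /= big_ord1.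
      by rewrite [in RHS]sumE.
    under eq_bigr do rewrite scalerDl -scalerA.
    rewrite big_split /= -scaler_sumr -/b addrC -[RHS]cu big_sumType /= big_ord1.
    by rewrite [in RHS]sumE; under [in RHS]eq_bigr do rewrite cast_ordKV.
  case=> [i|j]; first by rewrite (ord1 i) mulr1.
  by rewrite -[j](cast_ordK (congr1 S (subn0 d))) cr mulrN.
by move=> j; rewrite oppr_lt0.
Qed.

(** Positive weights stay nonnegative under a small enough perturbation in a given direction. *)
Lemma small_scale (I : finType) (a c : I -> R) : (forall i, 0 < a i) ->
  exists2 e, 0 < e & forall i, e * `|c i| <= a i.
Proof.
move=> a0; pose S := \sum_i `|c i| / a i.
have S0 : 0 <= S by apply: sumr_ge0 => i _; rewrite divr_ge0 // ltW.
have S1 : 0 < 1 + S by rewrite ltr_pwDl.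
exists (1 + S)^-1 => [|i]; first by rewrite invr_gt0.
rewrite mulrC ler_pdivrMr // mulrC -ler_pdivrMr // /S (bigD1 i) //= addrCA lerDl.
by rewrite addr_ge0 // sumr_ge0 // => j _; rewrite divr_ge0 // ltW.
Qed.

(** Subtracting s (a, -b) from a relation leaves coefficients with zero sum on each side. Their [v]
    part is a direction in which x can move a little inside both simplices; as these meet only at x,
    it is zero, and independence makes all the remaining coefficients vanish. *)
Lemma spans_relations_crossing m n (v : 'I_m.+1 -> 'rV[R]_d)
    (w : 'I_n.+1 -> 'rV[R]_d) x a b :
  affinely_independent v -> affinely_independent w ->
  convex_hull (range v) `&` convex_hull (range w) = [set x] ->
  (forall i, 0 < a i) -> \sum_i a i = 1 -> x = \sum_i a i *: v i ->
  (forall j, 0 < b j) -> \sum_j b j = 1 -> x = \sum_j b j *: w j ->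
  let u z := match z with inl i => v i | inr j => w j end in
  let k z := match z with inl i => a i | inr j => - b j end in
  affine_relation u k /\ spans_relations u k.
Proof.
move=> v_ind w_ind vw a0 a1 xv b0 b1 xw u k; split.
  split; rewrite big_sumType /=; first by rewrite sumrN a1 b1 subrr.
  under [X in _ + X]eq_bigr do rewrite scaleNr.
  by rewrite sumrN -xv -xw subrr.
move=> c [c0 cu]; rewrite !big_sumType /= in c0 cu.
set s := \sum_i c (inl i) in c0.
have sr : \sum_j c (inr j) = - s by apply/eqP; rewrite -addr_eq0 addrC c0.
pose al i := c (inl i) - s * a i; pose be j := c (inr j) + s * b j.
have al0 : \sum_i al i = 0 by rewrite sumrB -mulr_sumr a1 mulr1 subrr.
have be0 : \sum_j be j = 0 by rewrite big_split /= -mulr_sumr b1 mulr1 sr addNr.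
have ab : \sum_i al i *: v i + \sum_j be j *: w j = 0.
  under eq_bigr do rewrite scalerBl -scalerA.
  under [X in _ + X]eq_bigr do rewrite scalerDl -scalerA.
  rewrite sumrB big_split /= -!scaler_sumr -xv -xw addrACA cu add0r.
  by rewrite addNr.
pose g (z : 'I_m.+1 + 'I_n.+1) := match z with inl i => a i | inr j => b j end.
have [|e e0 eP] := @small_scale _ g
  (fun z => match z with inl i => al i | inr j => be j end); first by case.
have yx : x + e *: \sum_i al i *: v i = x.
  suff : (convex_hull (range v) `&` convex_hull (range w))
    (x + e *: \sum_i al i *: v i) by rewrite vw.
  split.
    apply/convex_hull_rangeP; exists (fun i => a i + e * al i).
      split=> [i|]; last by rewrite big_split /= -mulr_sumr al0 mulr0 addr0.
      have := eP (inl i); rewrite /= -[e in e * _]gtr0_norm // -normrM ler_norml.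
      by case/andP=> + _; rewrite -subr_ge0 opprK addrC.
    rewrite xv scaler_sumr -big_split /=; apply: eq_bigr => i _.
    by rewrite scalerA scalerDl.
  apply/convex_hull_rangeP; exists (fun j => b j - e * be j).
    split=> [j|]; last by rewrite sumrB -mulr_sumr be0 mulr0 subr0.
    have := eP (inr j); rewrite /= -[e in e * _]gtr0_norm // -normrM ler_norml.
    by case/andP=> _; rewrite -subr_ge0.
  move/eqP: ab; rewrite addr_eq0 => /eqP ->.
  rewrite scalerN xw scaler_sumr -sumrB /=; apply: eq_bigr => j _.
  by rewrite scalerA scalerBl.
have alv : \sum_i al i *: v i = 0.
  move/eqP: yx; rewrite -subr_eq0 addrAC subrr add0r scaler_eq0 gt_eqF //=.
  by move/eqP.
have bew : \sum_j be j *: w j = 0 by move: ab; rewrite alv add0r.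
exists s; case=> [i|j].
  move/affinely_independentP: v_ind => /(_ al (conj al0 alv) i)/eqP.
  by rewrite subr_eq0 => /eqP.
move/affinely_independentP: w_ind => /(_ be (conj be0 bew) j)/eqP.
by rewrite addr_eq0 mulrN => /eqP.
Qed.

Lemma range_sum (I J : finType) (v : I -> 'rV[R]_d) (w : J -> 'rV[R]_d) :
  range v `|` range w =
  range (fun z => match z with inl i => v i | inr j => w j end).
Proof.
apply/seteqP; split=> [_ [[i _ <-]|[j _ <-]]|_ [[i|j] _ <-]].
- by exists (inl i).
- by exists (inr j).
- by left; exists i.
- by right; exists j.
Qed.

(** For m > 0 all d + 2 points of the two simplices are extreme, so they are the points p_i up to
    reindexing. The crossing relation is thus proportional to [l]. *)
Lemma sign_pattern_of_type m (p : 'I_d.+2 -> 'rV[R]_d) l :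
  (0 < m)%N -> (m <= d./2)%N ->
  (affine_hull (range p) = setT -> spans_relations p l) ->
  has_type d m (convex_hull (range p)) -> sign_pattern m l.
Proof.
move=> m0 md span [dimT [v [w /= [_ v_ind w_ind TE [x [vw xv xw]]]]]].
have {}span : spans_relations p l.
  by apply: span; rewrite -affine_hull_convex_hull has_affine_dim_full.
have [a [a0 a1 xa]] := relative_interior_weights xv.
have [b [b0 b1 xb]] := relative_interior_weights xw.
have [] := spans_relations_crossing v_ind w_ind vw a0 a1 xa b0 b1 xb.
set u := fun z => _; set k := fun z => _ => uk uspan.
have nm : (0 < d - m)%N by lia.
(* Such an expression of [u z] would be a relation with coefficient 1 at [z] and none positive
   elsewhere, but the sign class of [z] in [k] has a second element. *)
have ext z c : convex_weights c -> c z = 0 -> u z <> \sum_y c y *: u y.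
  move=> [c0 c1] cz uz.
  have [t ct] := uspan _ (affine_relation_point c1 uz).
  have tz : 1 = t * k z by rewrite -ct eqxx cz subr0.
  have [y [yz yk]] : exists y, y != z /\ 0 < k y * k z.
    case: z {cz uz tz ct} => [i|j].
      have [i' ii'] := other_ord i m0; exists (inl i'); split=> //.
      by rewrite /k mulr_gt0.
    have [j' jj'] := other_ord j nm; exists (inr j'); split=> //.
    by rewrite /k mulrNN mulr_gt0.
  have : 0 < t * k y.
    rewrite -(pmulr_lgt0 _ (_ : 0 < (k z) ^+ 2)).
      by rewrite expr2 mulrACA mulrA mulrAC -tz mul1r mulrC.
    rewrite lt_neqAle sqr_ge0 andbT eq_sym expf_eq0 /=.
    by apply: contra_eq_neq tz => ->; rewrite mulr0 oner_neq0.
  by rewrite -ct (negbTE yz) sub0r oppr_gt0 ltNge c0.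
have pu : convex_hull (range p) = convex_hull (range u) by rewrite TE range_sum.
have /choice[f fP] : forall z, exists i, p i = u z.
  by move=> z; apply: (extreme_point_range pu (ext z)).
have f_inj : injective f.
  move=> z z' ff; apply/eqP/negPn/negP => zz'.
  apply: (ext z (fun y => (y == z')%:R)).
  - split=> [y|]; first by rewrite ler0n.
    by rewrite (bigD1 z') //= eqxx big1 ?addr0 // => y /negbTE ->.
  - by rewrite (negbTE zz').
  - rewrite (bigD1 z') //= eqxx scale1r big1 ?addr0 -?fP ?ff //.
    by move=> y /negbTE ->; rewrite scale0r.
have f_bij : bijective f.
  by apply: (inj_card_bij f_inj); rewrite card_sum !card_ord; lia.
have [g fK gK] := f_bij.
have [|t kt] := span (k \o g).
  have [k0 ku] := uk.
  split; rewrite (reindex f) /=; try exact: onW_bij.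
    by under eq_bigr do rewrite fK.
  by under eq_bigr do rewrite fK fP.
have t0 : t != 0.
  have := kt (f (inl ord0)); rewrite /= fK => kE.
  apply: contraTneq (a0 ord0) => t0.
  by rewrite -[a ord0]/(k (inl ord0)) kE t0 mul0r ltxx.
rewrite -(sign_patternZ m t0 kt) /sign_pattern.
case: m m0 => // m _ in v w a b a0 a1 xa b0 b1 xb u k uk uspan f fP f_inj
  f_bij g fK gK kt md nm v_ind w_ind TE xv xw vw ext pu *.
have -> : num_pos (k \o g) = m.+2.
  rewrite /num_pos -sum1dep_card big_mkcond (reindex f) /=; last exact: onW_bij.
  under eq_bigr do rewrite fK.
  rewrite big_sumType /=; under eq_bigr do rewrite a0.
  rewrite sum_nat_const card_ord muln1 big1 ?addn0 // => j _.
  by rewrite oppr_gt0 ltNge (ltW (b0 j)).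
have -> : num_neg (k \o g) = (d - m.+1).+1.
  rewrite /num_neg -sum1dep_card big_mkcond (reindex f) /=; last exact: onW_bij.
  under eq_bigr do rewrite fK.
  rewrite big_sumType /= big1 ?add0n => [|i _]; last by rewrite ltNge (ltW (a0 i)).
  under eq_bigr do rewrite oppr_lt0 b0.
  by rewrite sum_nat_const card_ord muln1.
by rewrite !eqxx.
Qed.

(** The single point of V lies in conv W, so the hull is the simplex conv W, whose d + 1 vertices
    are among the p_i. A point p_(i0) left over lies in it, which gives a relation whose only
    positive coefficient is at [i0]. *)
Lemma sign_pattern_of_type0 (p : 'I_d.+2 -> 'rV[R]_d) l :
  (affine_hull (range p) = setT -> spans_relations p l) ->
  has_type d 0 (convex_hull (range p)) -> sign_pattern 0 l.
Proof.
rewrite /has_type subn0.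
move=> span [dimT [v [w /= [_ v_ind w_ind TE [x [vw xv xw]]]]]].
have {}span : spans_relations p l.
  by apply: span; rewrite -affine_hull_convex_hull has_affine_dim_full.
have xW : convex_hull (range w) x by case: xw.
have vx i : v i = x.
  have [a [_ a1 ->]] := relative_interior_weights xv.
  by move: a1; rewrite !big_ord1 => ->; rewrite scale1r (ord1 i).
have pw : convex_hull (range p) = convex_hull (range w).
  rewrite TE; apply/seteqP; split; apply/convex_hull_subset.
    by move=> y [[i _ <-]|wy]; [rewrite vx|exact: sub_convex_hull].
  by move=> y wy; apply: sub_convex_hull; right.
have /choice[f fP] : forall j, exists i, p i = w j.
  move=> j; apply: (extreme_point_range pw) => c [c0 c1] cj wj.
  move/affinely_independentP: w_ind => /(_ _ (affine_relation_point c1 wj) j)/eqP.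
  by rewrite eqxx cj subr0 oner_eq0.
have [i0 i0f] : exists i0, i0 \notin codom f.
  apply/existsP; rewrite -negb_forall; apply/negP => /forallP fs.
  have := leq_image_card f predT; rewrite (eq_card (B := predT)) => [|i].
    by rewrite !card_ord ltnn.
  by rewrite fs.
have /convex_hull_rangeP[c [c0 c1] pi0] : convex_hull (range w) (p i0).
  by rewrite -pw; apply: sub_convex_hull; exists i0.
(* The weight of p_i is collected over the fibre of [f] at [i]. *)
pose k i := (i == i0)%:R - \sum_(j | f j == i) c j.
have [|t kt] := span k.
  split; rewrite ?sumrB.
    have <- : \sum_j c j = \sum_i \sum_(j | f j == i) c j.
      by rewrite (partition_big f predT).
    rewrite c1 (bigD1 i0) //= eqxx.
    by rewrite big1 ?addr0 ?subrr // => i /negbTE ->.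
  under eq_bigr do rewrite scalerBl scaler_suml.
  rewrite sumrB.
  have <- : p i0 = \sum_i \sum_(j | f j == i) c j *: p i.
    rewrite pi0 (partition_big f predT) //=; apply: eq_bigr => i _.
    by apply: eq_bigr => j /eqP <-; rewrite fP.
  rewrite (bigD1 i0) //= eqxx scale1r big1 ?addr0 ?subrr // => i /negbTE ->.
  by rewrite scale0r.
have ki0 : k i0 = 1.
  rewrite /k eqxx big_pred0 ?subr0 // => j.
  by apply/negbTE; apply: contraNneq i0f => <-; exact: codom_f.
have t0 : t != 0.
  by apply: contra_eq_neq ki0 => t0; rewrite kt t0 mul0r eq_sym oner_neq0.
rewrite -[_ || _]/(sign_pattern 0 l) -(sign_patternZ 0 t0 kt) /sign_pattern /num_pos.
rewrite (_ : [set i | 0 < k i]%SET = [set i0]%SET) ?cards1 //.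
apply/finset.setP => i; rewrite !inE; have [->|ii0] := eqVneq i i0.
  by rewrite ki0 ltr01.
by rewrite /k (negbTE ii0) sub0r oppr_gt0 ltNge sumr_ge0.
Qed.

(** The conditional hypotheses admit degenerate points: if [l] vanishes, neither side holds. The
    equivalence therefore has no exceptional configurations. *)
Lemma has_typeP m (p : 'I_d.+2 -> 'rV[R]_d) l :
  (0 < d)%N -> (m <= d./2)%N -> affine_relation p l ->
  ((exists i, l i != 0) -> spans_relations p l) ->
  (affine_hull (range p) = setT -> exists i, l i != 0) ->
  has_type d m (convex_hull (range p)) <-> sign_pattern m l.
Proof.
move=> d0 md lp span full; split.
  have {}span : affine_hull (range p) = setT -> spans_relations p l.
    by move=> /full; exact: span.
  have [->|m0] := posnP m; first exact: sign_pattern_of_type0.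
  exact: sign_pattern_of_type.
have span_pos k : num_pos l = k.+1 -> spans_relations p l.
  move=> lk; apply: span; have /card_gt0P[i] : (0 < num_pos l)%N by rewrite lk.
  by rewrite inE => li; exists i; rewrite gt_eqF.
have span_neg k : num_neg l = k.+1 -> spans_relations p l.
  move=> lk; apply: span; have /card_gt0P[i] : (0 < num_neg l)%N by rewrite lk.
  by rewrite inE => li; exists i; rewrite lt_eqF.
have lN i : - l i = -1 * l i by rewrite mulN1r.
have N1 : -1 < 0 :> R by rewrite oppr_lt0.
rewrite /sign_pattern; case: m md => [|m] md.
  case/orP => /eqP l1.
    exact: (has_type0_of_count d0 lp (span_pos _ l1) l1).
  apply: (has_type0_of_count d0 (affine_relationN lp)).
    by apply: spans_relationsN; exact: span_neg l1.
  by rewrite (num_posN N1 lN).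
have md' : (m.+1 <= d)%N by lia.
case/orP => /andP[/eqP l1 /eqP l2].
  exact: (has_type_of_counts d0 md' lp (span_pos _ l1) l1 l2).
apply: (has_type_of_counts d0 md' (affine_relationN lp)).
- by apply: spans_relationsN; exact: span_neg l2.
- by rewrite (num_posN N1 lN).
- by rewrite (num_negN N1 lN).
Qed.

End Types.

(** * Affine relations between the partial sums *)

Section Walk.
Variables (R : realType) (d : nat).
Implicit Types (x : 'I_d.+1 -> 'rV[R]_d) (a c : 'I_d.+1 -> R).

(* The coefficients that Cramer's rule gives to a linear relation between d + 1
   vectors in dimension d. *)
Definition minors x (j : 'I_d.+1) : R := (-1) ^+ j * \det (row' j (\matrix_k x k)).

(** For each coordinate k, the sum is the expansion along the first column of a determinant in which
    column k is repeated. *)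
Lemma minors_relation x : \sum_j minors x j *: x j = 0.
Proof.
apply/rowP => k; rewrite summxE mxE.
pose B : 'M[R]_d.+1 := row_mx (col k (\matrix_j x j)) (\matrix_j x j).
transitivity (\det B); last first.
  rewrite -det_tr; apply: (@determinant_alternate _ _ _ ord0 (lift ord0 k)) => // j.
  rewrite !mxE; case: splitP => [i _|i //].
  case: splitP => [i' /= i'E|i' /= i'E]; first by rewrite (ord1 i') in i'E.
  by rewrite !mxE; congr (x j 0 _); apply/val_inj; move: i'E; rewrite /= /bump; lia.
rewrite (expand_det_col _ ord0); apply: eq_bigr => j _.
rewrite !mxE mulrC; case: splitP => [i _|i //]; rewrite !mxE; congr (_ * _).
rewrite /cofactor addn0; congr (_ * \det _).
apply/matrixP => i1 i2; rewrite !mxE; case: splitP => [i' i'E|i' i'E].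
  by have := ltn_ord i'; rewrite -i'E /= /bump; lia.
by rewrite !mxE; congr (x _ 0 _); apply/val_inj; move: i'E; rewrite /= /bump; lia.
Qed.

(** Subtracting the multiple that cancels the coefficient at [j0] leaves a relation between the
    other d vectors, which are independent since their minor is nonzero. *)
Lemma linear_relation_minors x c j0 : minors x j0 != 0 ->
  \sum_j c j *: x j = 0 -> exists t, forall j, c j = t * minors x j.
Proof.
move=> x0 cx; exists (c j0 / minors x j0) => j.
set t := _ / _; apply/eqP; rewrite -subr_eq0; apply/eqP.
have tj0 : c j0 - t * minors x j0 = 0 by rewrite divfK ?subrr.
have [i ->|-> //] := unliftP j0 j.
have U : row' j0 (\matrix_k x k) \in unitmx.
  rewrite unitmxE unitfE; apply: contraNneq x0 => D0.
  by rewrite /minors D0 mulr0.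
pose u := \row_i (c (lift j0 i) - t * minors x (lift j0 i)).
suff /rowP/(_ i) : u = 0 by rewrite !mxE.
apply: (row_free_inj (_ : row_free (row' j0 (\matrix_k x k)))).
  by rewrite row_free_unit.
rewrite mul0mx mulmx_sum_row.
transitivity (\sum_j (c j - t * minors x j) *: x j).
  rewrite [RHS](bigD1_ord j0) //= tj0 scale0r add0r; apply: eq_bigr => k _.
  by rewrite mxE; congr (_ *: _); apply/rowP => l; rewrite !mxE.
under eq_bigr do rewrite scalerBl -scalerA.
by rewrite sumrB -scaler_sumr cx minors_relation scaler0 subrr.
Qed.

Lemma row_full_minors x : row_full (\matrix_k x k) <-> exists j, minors x j != 0.
Proof.
split=> [xfull|[j xj]]; last first.
  have U : row' j (\matrix_k x k) \in unitmx.
    rewrite unitmxE unitfE; apply: contraNneq xj => D0.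
    by rewrite /minors D0 mulr0.
  rewrite -sub1mx; apply: submx_trans (_ : (row' j (\matrix_k x k) <= _)%MS).
    by rewrite sub1mx row_full_unit.
  apply/row_subP => i.
  rewrite (_ : row i _ = row (lift j i) (\matrix_k x k)) ?row_sub //.
  by apply/rowP => l; rewrite !mxE.
(* These d independent rows miss some index j, so they are all rows of the submatrix without row
   j. *)
pose f := fullrankfun xfull.
have [j jf] : exists j, j \notin codom f.
  apply/existsP; rewrite -negb_forall; apply/negP => /forallP fs.
  have := leq_image_card f predT; rewrite (eq_card (B := predT)) => [|i].
    by rewrite !card_ord ltnn.
  by rewrite fs.
exists j; rewrite mulf_neq0 ?signr_eq0 // -unitfE -unitmxE -row_full_unit -sub1mx.
have := fullrowsub_full xfull; rewrite -sub1mx => /submx_trans; apply.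
apply/row_subP => i; rewrite row_rowsub.
have [k fk|fk] := unliftP j (f i); last by rewrite -fk codom_f in jf.
rewrite fk (_ : row _ _ = row k (row' j (\matrix_k x k))) ?row_sub //.
by apply/rowP => l; rewrite !mxE.
Qed.

(** Permuting the vectors permutes their relations, which form a line, so no sign has to be
    computed. The factor is nonzero because the permuted vectors still have full rank. *)
Lemma minors_perm x (s : 'S_d.+1) : (exists j, minors x j != 0) ->
  exists2 t, t != 0 & forall j, minors (x \o s) j = t * minors x (s j).
Proof.
move=> x0; have [j0 xj0] := x0.
have [|t tP] := @linear_relation_minors x (minors (x \o s) \o s^-1%g) j0 xj0.
  rewrite -[RHS](minors_relation (x \o s)) (reindex_inj (@perm_inj _ s)).
  by apply: eq_bigr => j _; rewrite /= permK.
have tE j : minors (x \o s) j = t * minors x (s j) by rewrite -tP /= permK.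
exists t => //; apply/eqP => t0.
have [j] : exists j, minors (x \o s) j != 0.
  apply/row_full_minors; move/row_full_minors: x0.
  rewrite -!sub1mx => /submx_trans; apply.
  apply/row_subP => i.
  rewrite (_ : row i _ = row ((s^-1)%g i) (\matrix_k (x \o s) k)) ?row_sub //.
  by rewrite !rowK /= permKV.
by rewrite tE t0 mul0r eqxx.
Qed.

Definition walk x (i : nat) : 'rV[R]_d := \sum_(j < d.+1 | (j < i)%N) x j.

Lemma walk0 x : walk x 0 = 0.
Proof. by rewrite /walk big_pred0. Qed.

Lemma walkS x (i : 'I_d.+1) : walk x i.+1 = walk x i + x i.
Proof.
rewrite /walk (bigD1 i) //= addrC; congr (_ + _); apply: eq_bigl => j.
by rewrite ltnS -val_eqE ltn_neqAle andbC.
Qed.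

Lemma walk_sub x (i : nat) : (walk x i <= \matrix_k x k)%MS.
Proof.
apply: summx_sub => j _; rewrite (_ : x j = row j (\matrix_k x k)) ?row_sub //.
by rewrite rowK.
Qed.

Lemma sum_cdiff (a : 'I_d.+1 -> R) : \sum_i cdiff a i = 0.
Proof.
rewrite sumrB big_ord_recl [X in _ - X]big_ord_recr /= bordered_last addr0 add0r.
by apply/eqP; rewrite subr_eq0; apply/eqP/eq_bigr.
Qed.

Lemma sum_cdiff_walk x a : \sum_i cdiff a i *: walk x i = \sum_j a j *: x j.
Proof.
under eq_bigr do rewrite scalerBl.
rewrite sumrB big_ord_recl [X in _ - X]big_ord_recr /= bordered_last !scale0r.
rewrite addr0 add0r -sumrB; apply: eq_bigr => i _.
by rewrite /bump add1n bordered_ord -scalerBr walkS addrAC subrr add0r.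
Qed.

Lemma cdiffP (c : 'I_d.+2 -> R) : \sum_i c i = 0 -> exists a, forall i, c i = cdiff a i.
Proof.
(* Undoing the differences gives minus the partial sums of [c]; the zero total matches the final 0
   of the bordered sequence. *)
move=> c0; pose a (j : 'I_d.+1) := - \sum_(i < d.+2 | (i < j.+1)%N) c i; exists a.
have aE k : (k <= d.+2)%N -> bordered a k = - \sum_(i < d.+2 | (i < k)%N) c i.
  case: k => [_|k]; first by rewrite big_pred0 ?oppr0.
  rewrite ltnS leq_eqVlt => /orP[/eqP ->|kd].
    rewrite bordered_last (eq_bigl predT) ?c0 ?oppr0 // => i.
    by rewrite ltn_ord.
  by rewrite (bordered_ord a (Ordinal kd)).
move=> i; rewrite /cdiff !aE ?(ltnW (ltn_ord i)) // opprK addrC.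
rewrite (bigD1 i) //= (eq_bigl (fun j : 'I__ => (j < i)%N)) ?addrK // => j.
by rewrite ltnS -val_eqE ltn_neqAle andbC.
Qed.

Lemma cdiffZ a a' t :
  (forall j, a' j = t * a j) -> forall i, cdiff a' i = t * cdiff a i.
Proof.
move=> aa'; have E k : bordered a' k = t * bordered a k.
  case: k => [|k]; rewrite /bordered ?mulr0 //.
  by case: insub => [j|] /=; rewrite ?mulr0.
by move=> i; rewrite /cdiff !E mulrBr.
Qed.

Lemma cdiff_neq0 a : (exists i, cdiff a i != 0) <-> exists j, a j != 0.
Proof.
split=> [[i ai]|[j aj]].
  apply/existsP; apply: contraNT ai; rewrite negb_exists => /forallP a0.
  rewrite (@cdiffZ a a 0) ?mul0r // => j; rewrite mul0r.
  by move: (a0 j); rewrite negbK => /eqP.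
apply/existsP; apply: contraNT aj; rewrite negb_exists => /forallP a0.
suff E k : (k <= d.+1)%N -> bordered a k = 0 by rewrite -bordered_ord E.
elim: k => [//|k IHk] kd; have := a0 (Ordinal (leqW kd)).
by rewrite negbK /cdiff /= IHk 1?ltnW // sub0r oppr_eq0 => /eqP.
Qed.

Definition walk_coef x : 'I_d.+2 -> R := cdiff (minors x).

Lemma walk_relation x : affine_relation (walk x : 'I_d.+2 -> _) (walk_coef x).
Proof. by split; [exact: sum_cdiff|rewrite sum_cdiff_walk minors_relation]. Qed.

Lemma walk_spans x : (exists i, walk_coef x i != 0) ->
  spans_relations (walk x : 'I_d.+2 -> _) (walk_coef x).
Proof.
move=> /cdiff_neq0[j xj] c [/cdiffP[a aE] cx].
have [|t ta] := linear_relation_minors xj (c := a).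
  by rewrite -sum_cdiff_walk -[RHS]cx; apply: eq_bigr => i _; rewrite aE.
by exists t => i; rewrite aE (cdiffZ ta).
Qed.

Lemma walk_coef_full x : row_full (\matrix_k x k) -> exists i, walk_coef x i != 0.
Proof. by move/row_full_minors/cdiff_neq0. Qed.

Lemma has_type_walkP m x : (0 < d)%N -> (m <= d./2)%N ->
  has_type d m (convex_hull (range (walk x : 'I_d.+2 -> _))) <->
  sign_pattern m (walk_coef x).
Proof.
move=> d0 md; apply: has_typeP => //; first exact: walk_relation.
  exact: walk_spans.
(* The partial sums lie in the row space of the increments, so a full affine hull forces full
   rank. *)
move=> xT; apply: walk_coef_full; rewrite -sub1mx; apply/row_subP => k.
have /affine_hull_rangeP[c _ ->] :
  affine_hull (range (walk x : 'I_d.+2 -> _)) (row k 1%:M) by rewrite xT.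
by apply: summx_sub => i _; apply: scalemx_sub; exact: walk_sub.
Qed.

Lemma free_enumP n k (f : 'I_k -> 'rV[R]_n) :
  reflect (forall c : 'I_k -> R, \sum_i c i *: f i = 0 -> forall i, c i = 0)
          (free [seq f i | i <- enum 'I_k]).
Proof.
have -> : free [seq f i | i <- enum 'I_k] = free [tuple f i | i < k] by [].
apply: (iffP freeP) => f_free c cf; apply: f_free; rewrite -[RHS]cf;
  by apply: eq_bigr => i _; rewrite -tnth_nth tnth_mktuple.
Qed.

(** Translates (GP) into coefficients. As S_0 = 0, a linear relation between the other partial sums
    becomes an affine one once S_0 receives the missing weight; the left side omits exactly the
    partial sum of index i0 + 1. *)
Lemma free_walkP x (i0 : 'I_d.+1) :
  free [seq walk x (lift i0 k).+1 | k <- enum 'I_d] =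
  (walk_coef x (lift ord0 i0) != 0).
Proof.
apply/free_enumP/idP => [xfree|xi0 c cx k].
  apply/negP => /eqP xi0; have [_] := walk_relation x.
  rewrite big_ord_recl walk0 scaler0 add0r (bigD1_ord i0) //= xi0 scale0r add0r.
  move=> /xfree x0.
  have [i] : exists i, walk_coef x i != 0.
    apply: walk_coef_full; rewrite -sub1mx.
    have : row_free (\matrix_k walk x (lift i0 k).+1).
      apply: inj_row_free => v; rewrite mulmx_sum_row => v0.
      apply/rowP => k; rewrite mxE; apply: (xfree (v 0)).
      by rewrite -[RHS]v0; apply: eq_bigr => j _; rewrite rowK.
    rewrite row_free_unit -row_full_unit -sub1mx => /submx_trans; apply.
    by apply/row_subP => k; rewrite rowK; exact: walk_sub.
  have cE i' : i' != ord0 -> walk_coef x i' = 0.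
    have [j -> _|-> /eqP //] := unliftP ord0 i'.
    by have [k ->|-> //] := unliftP i0 j; exact: x0.
  have [->|/cE ->] := eqVneq i ord0; last by rewrite eqxx.
  have [+ _] := walk_relation x; rewrite (bigD1 ord0) //= big1 ?addr0 => [->|j /cE //].
  by rewrite eqxx.
(* Extend [c] by 0 at the omitted point and by minus the total at the origin. *)
pose C0 i := oapp c 0 (unlift i0 i).
pose C i := oapp C0 (- \sum_j C0 j) (unlift ord0 i).
have [||t Ct] := @walk_spans x _ C.
- by exists (lift ord0 i0).
- split; rewrite big_ord_recl.
    rewrite /C unlift_none /=.
    by under [X in _ + X]eq_bigr do rewrite liftK /=; rewrite addNr.
  rewrite walk0 scaler0 add0r (bigD1_ord i0) //=.
  rewrite {1}/C liftK /= {1}/C0 unlift_none /= scale0r add0r -[RHS]cx.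
  by apply: eq_bigr => j _; rewrite /C liftK /= /C0 liftK.
have t0 : t = 0.
  have /esym/eqP := Ct (lift ord0 i0).
  by rewrite /C liftK /= /C0 unlift_none /= mulf_eq0 (negbTE xi0) orbF => /eqP.
by have := Ct (lift ord0 (lift i0 k)); rewrite /C liftK /= /C0 liftK /= t0 mul0r.
Qed.

Lemma perm_two (i0 i1 j k : 'I_d.+1) : i0 != i1 -> j != k ->
  exists s : 'S_d.+1, s i0 = j /\ s i1 = k.
Proof.
move=> ii jk; exists (tperm i1 (tperm i0 j k) * tperm i0 j)%g.
rewrite !permM tpermL tpermK; split=> //.
have kk : tperm i0 j k != i0.
  by rewrite (can2_eq (tpermK i0 j) (tpermK i0 j)) tpermL eq_sym.
by rewrite [tperm i1 _ _]tpermD ?tpermL // eq_sym.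
Qed.

(** For one order of the increments, the hypothesis says that consecutive minors differ and that the
    last is nonzero. A permutation can make any two minors consecutive, or any one the last. *)
Lemma generic_minors x : (0 < d)%N ->
  (forall (s : 'S_d.+1) i, walk_coef (x \o s) (lift ord0 i) != 0) ->
  injective (minors x) /\ forall j, minors x j != 0.
Proof.
move=> d0 gen.
have x0 : exists j, minors x j != 0.
  apply/cdiff_neq0; exists (lift ord0 ord0); have := gen 1%g ord0.
  rewrite (_ : x \o _ = x) //; apply/funext => i /=.
  by rewrite perm1.
have genE (s : 'S_d.+1) i : cdiff (minors x \o s) (lift ord0 i) != 0.
  have [t t0 tP] := minors_perm s x0.
  by have := gen s i; rewrite /walk_coef (cdiffZ tP) mulf_eq0 negb_or => /andP[].
split=> [j k jk|j].
  apply/eqP/negPn/negP => nejk.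
  have [||s [sj sk]] := @perm_two ord0 (lift ord0 (Ordinal d0)) j k.
  - exact: neq_lift.
  - exact: nejk.
  have := genE s ord0; rewrite /cdiff lift0.
  rewrite (bordered_ord _ ord0) -[1%N]/(nat_of_ord (lift ord0 (Ordinal d0))).
  by rewrite bordered_ord /= sj sk jk subrr eqxx.
have := genE (tperm ord_max j) ord_max; rewrite /cdiff lift0 bordered_last subr0.
by rewrite (bordered_ord _ ord_max) /= tpermL.
Qed.

(** No difference vanishes, so the two counts add up to d + 2 and the pattern says that one of them
    is m + 1. Each alternative has an Eulerian number of permutations; the two coincide if 2m = d
    and are disjoint otherwise, whence [eta]. *)
Lemma card_sign_pattern m a : (0 < d)%N -> (m <= d./2)%N ->
  injective a -> (forall j, a j != 0) ->
  #|[set s : 'S_d.+1 | sign_pattern m (cdiff (a \o s))]%SET| =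
  (eta d m * eulerian d.+1 m)%N.
Proof.
move=> d0 md a_inj a0.
have posneg (s : 'S_d.+1) :
    (num_pos (cdiff (a \o s)) + num_neg (cdiff (a \o s)) = d.+2)%N.
  rewrite /num_pos /num_neg -[RHS]card_ord -cardsUI.
  rewrite [X in (_ + X)%N](_ : _ = 0%N) ?addn0; last first.
    apply/eqP; rewrite cards_eq0 -finset.subset0; apply/fintype.subsetP => i.
    by rewrite !inE => /andP[/ltW]; rewrite leNgt => /negbTE ->.
  apply: eq_card => i; rewrite !inE orbC -neq_lt /cdiff subr_eq0.
  have [j ->|->] := unliftP ord0 i; last first.
    by rewrite eq_sym (bordered_ord _ ord0) /= a0.
  rewrite lift0 bordered_ord; have [jd|jd] := ltnP j d.
    rewrite (bordered_ord _ (Ordinal (jd : (j.+1 < d.+1)%N))) /= (inj_eq a_inj).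
    by rewrite (inj_eq perm_inj) -val_eqE /= neq_ltn ltnSn.
  have -> : j = d :> nat by have := ltn_ord j; lia.
  by rewrite bordered_last /= a0.
pose A := [set s : 'S_d.+1 | num_pos (cdiff (a \o s)) == m.+1]%SET.
pose B := [set s : 'S_d.+1 | num_neg (cdiff (a \o s)) == m.+1]%SET.
have -> : [set s : 'S_d.+1 | sign_pattern m (cdiff (a \o s))]%SET = (A :|: B)%SET.
  apply/finset.setP => s; rewrite !inE /sign_pattern; have := posneg s.
  by case: m {A B} md => // m md; lia.
have cA : #|A| = eulerian d.+1 m by exact: card_num_pos_cdiff.
have cB : #|B| = eulerian d.+1 m by exact: card_num_neg_cdiff.
rewrite /eta; case: eqP => dm.
  have -> : B = A by apply/finset.setP => s; rewrite !inE; have := posneg s; lia.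
  by rewrite finset.setUid cA mul1n.
rewrite cardsU cA cB (_ : A :&: B = finset.set0)%SET ?cards0 ?subn0; first lia.
by apply/finset.setP => s; rewrite !inE; have := posneg s; lia.
Qed.

End Walk.

(** * Exchangeability *)

Lemma measurable_card dsp (T : measurableType dsp) (I : finType)
    (F : I -> T -> bool) k : (forall i, measurable_fun setT (F i)) ->
  measurable_fun setT (fun t => #|[set i | F i t]%SET| == k).
Proof.
move=> mF; apply: (measurable_fun_bool true); rewrite setTI.
rewrite (_ : _ @^-1` _ = \bigcup_(A in [set A : {set I} | #|A| == k])
    \bigcap_(i in [set: I]) (F i @^-1` [set i \in A])).
  apply: fin_bigcup_measurable => [|A _]; first exact: finite_finset.
  apply: fin_bigcap_measurable => [|i _]; first exact: finite_finset.
  by rewrite -[X in measurable X]setTI; exact: mF.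
apply/seteqP; split=> [t /= Ft|t [A /= /eqP <- FA]] /=.
  by exists [set i | F i t]%SET => //= i _ /=; rewrite inE.
by apply/eqP; congr #|pred_of_set _|; apply/finset.setP => i; rewrite inE; exact: FA.
Qed.

Lemma measurable_coord (R : realType) n (i : 'I_n) :
  measurable_fun setT (fun x : borel_rV R n => (x : 'rV[R]_n) 0 i).
Proof.
apply: (measurability _ (RGenOpens.measurableE R)) => _ [_ [a [b ->] <-]].
rewrite setTI; apply: sub_sigma_algebra.
apply: open_comp (interval_open _ _) => // x _; exact: coord_continuous.
Qed.

Lemma measurable_minors (R : realType) d (j : 'I_d.+1) :
  measurable_fun setT
    (fun t : d.+1.-tuple (borel_rV R d) => minors (tnth t : _ -> 'rV[R]_d) j).
Proof.
apply: measurable_funM; first exact: measurable_cst.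
(* The determinant is treated as its Leibniz sum, a polynomial in the coordinates. *)
apply: measurable_sum => s; apply: measurable_funM; first exact: measurable_cst.
apply: measurable_prod => i _.
under eq_fun do rewrite !mxE.
exact: measurableT_comp (measurable_coord _) (measurable_tnth _).
Qed.

Lemma measurable_walk_coef (R : realType) d (i : 'I_d.+2) :
  measurable_fun setT
    (fun t : d.+1.-tuple (borel_rV R d) => walk_coef (tnth t : _ -> 'rV[R]_d) i).
Proof.
have mb k : measurable_fun setT (fun t : d.+1.-tuple (borel_rV R d) =>
    bordered (minors (tnth t : _ -> 'rV[R]_d)) k).
  rewrite /bordered; case: k => [|k]; first exact: measurable_cst.
  by case: insub => [j|]; [exact: measurable_minors|exact: measurable_cst].
by apply: measurable_funB.
Qed.

Lemma measurable_sign_pattern (R : realType) d m :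
  measurable_fun setT (fun t : d.+1.-tuple (borel_rV R d) =>
    sign_pattern m (walk_coef (tnth t : _ -> 'rV[R]_d))).
Proof.
have mpos k : measurable_fun setT (fun t : d.+1.-tuple (borel_rV R d) =>
    num_pos (walk_coef (tnth t : _ -> 'rV[R]_d)) == k).
  apply: measurable_card => i; apply: measurable_fun_ltr; first exact: measurable_cst.
  exact: measurable_walk_coef.
have mneg k : measurable_fun setT (fun t : d.+1.-tuple (borel_rV R d) =>
    num_neg (walk_coef (tnth t : _ -> 'rV[R]_d)) == k).
  apply: measurable_card => i; apply: measurable_fun_ltr; last exact: measurable_cst.
  exact: measurable_walk_coef.
by case: m => [|m]; apply: measurable_or => //; apply: measurable_and.
Qed.

(** Double counting: the sum of the probabilities is the expected number of events that occur, which
    is almost surely c. *)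
Lemma probability_count dsp (T : measurableType dsp) (R : realType)
    (P : probability T R) (I : finType) (A : I -> set T) (G : set T) (c : nat)
    (p : R) :
  (forall i, measurable (A i)) -> measurable G -> P (~` G) = 0%E ->
  (forall i, P (A i) = p%:E) ->
  (forall w, G w -> #|[set i | w \in A i]%SET| = c) ->
  #|I|%:R * p = c%:R.
Proof.
move=> mA mG G0 Ap Ac.
have PG : P G = 1%E.
  by rewrite -(setCK G) probability_setC ?G0 ?sube0 //; exact: measurableC.
apply: EFin_inj; transitivity (\sum_(i : I) P (A i `&` G))%E.
  rewrite mulr_natl -sumr_const -sumEFin; apply: eq_bigr => i _.
  rewrite -(Ap i) -[in LHS](setUIDK (A i) G).
  apply: measureU0; [exact: measurableI|exact: measurableD|].
  apply/negligibleP; first exact: measurableD.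
  apply: (@negligibleS _ _ _ _ (~` G)); first by move=> w [].
  by apply/negligibleP => //; exact: measurableC.
under eq_bigr do rewrite -(integral_indic P mG (mA _)).
rewrite -ge0_integral_sum //.
- transitivity (\int[P]_(w in G) cst c%:R%:E w)%E.
    apply: eq_integral => w /set_mem Gw; rewrite sumEFin; congr (_%:E).
    rewrite -(Ac w Gw) -sum1dep_card natr_sum [RHS]big_mkcond.
    by apply: eq_bigr => i _; rewrite indicE; case: (w \in A i).
  rewrite integral_cst //; rewrite [X in (_ * X)%E](_ : _ = 1%E) ?mule1 //; exact: PG.
- by move=> i; apply/measurable_EFinP; exact: measurable_indic.
Qed.

Lemma measurable_walk_coef_eq0 (R : realType) d (i : 'I_d.+2) :
  measurable ((fun t : d.+1.-tuple (borel_rV R d) =>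
    walk_coef (tnth t : _ -> 'rV[R]_d) i == 0) @^-1` [set true]).
Proof.
have : measurable_fun setT (fun t : d.+1.-tuple (borel_rV R d) =>
    walk_coef (tnth t : _ -> 'rV[R]_d) i == 0).
  by apply: measurable_fun_eqr; [exact: measurable_walk_coef|exact: measurable_cst].
by move=> mf; rewrite -[X in measurable X]setTI; exact: mf.
Qed.

Lemma walk_hullE dsp (Omega : measurableType dsp) (R : realType)
    (P : probability Omega R) d (xi : 'I_d.+1 -> {RV P >-> borel_rV R d}) w :
  walk_hull xi w =
  convex_hull (range (walk (fun j => xi j w : 'rV[R]_d) : 'I_d.+2 -> _)).
Proof.
congr convex_hull; apply/seteqP; split=> [_ [i /= id <-]|_ [i _ <-]].
  by exists (Ordinal (id : (i < d.+2)%N)).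
by exists i => //=; rewrite -ltnS.
Qed.

(** * Permuted increments and their genericity *)

Section ExchangeableWalk.
Context dsp (Omega : measurableType dsp) (R : realType) (P : probability Omega R).
Context (d : nat) (xi : 'I_d.+1 -> {RV P >-> borel_rV R d}).

Let x w : 'I_d.+1 -> 'rV[R]_d := fun j => xi j w.

Definition permuted_increments (s : 'S_d.+1) w : d.+1.-tuple (borel_rV R d) :=
  [tuple xi (s i) w | i < d.+1].

Lemma measurable_permuted_increments s : measurable_fun setT (permuted_increments s).
Proof.
apply/measurable_fun_tnthP => i; rewrite (_ : _ \o _ = xi (s i)) //.
by apply/funext => w /=; rewrite tnth_mktuple.
Qed.

Lemma tnth_permuted_increments s w :
  (tnth (permuted_increments s w) : _ -> 'rV[R]_d) = x w \o s.
Proof. by apply/funext => i; rewrite tnth_mktuple. Qed.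

Lemma probability_permuted_increments s B : exchangeable xi -> measurable B ->
  P (permuted_increments s @^-1` B) = P (permuted_increments 1%g @^-1` B).
Proof.
move=> Ex mB; have := Ex s B mB; rewrite /pushforward => ->.
congr (P (_ @^-1` B)); apply/funext => w.
by apply: eq_from_tnth => i; rewrite !tnth_mktuple perm1.
Qed.

Lemma comp_perm1 w : x w \o (1%g : 'S_d.+1) = x w.
Proof. by apply/funext => i /=; rewrite perm1. Qed.

Lemma measurable_walk_coef0 (s : 'S_d.+1) i :
  measurable [set w | walk_coef (x w \o s) i = 0].
Proof.
rewrite (_ : mkset _ = permuted_increments s @^-1`
    ((fun t => walk_coef (tnth t : _ -> 'rV[R]_d) i == 0) @^-1` [set true])).
  rewrite -[X in measurable X]setTI; apply: measurable_permuted_increments => //.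
  exact: measurable_walk_coef_eq0.
by apply/seteqP; split=> w /=; rewrite tnth_permuted_increments => /eqP.
Qed.

(** Exchangeability reduces to the identity permutation, where [free_walkP] turns the event into the
    one of (GP) for the d indices other than i + 1. *)
Lemma walk_coef_neq0_ae (s : 'S_d.+1) (i : 'I_d.+1) :
  exchangeable xi -> general_position xi ->
  P [set w | walk_coef (x w \o s) (lift ord0 i) = 0] = 0%E.
Proof.
move=> Ex GP.
pose B := (fun t : d.+1.-tuple (borel_rV R d) =>
  walk_coef (tnth t : _ -> 'rV[R]_d) (lift ord0 i) == 0) @^-1` [set true].
have mB : measurable B by exact: measurable_walk_coef_eq0.
transitivity (P (permuted_increments s @^-1` B)).
  congr (P _); apply/seteqP.
  by split=> w; rewrite /B /= tnth_permuted_increments => /eqP.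
rewrite probability_permuted_increments //.
rewrite -[RHS](GP (fun k => (lift i k).+1)).
- congr (P _); apply/seteqP.
  split=> w; rewrite /B /= tnth_permuted_increments comp_perm1.
    by move=> xi0; rewrite (free_walkP (x w)) negbK.
  by rewrite (free_walkP (x w)) negbK.
- by move=> k; exact: (ltn_ord (lift i k)).
- by move=> a b ab; rewrite ltnS /= /bump; lia.
Qed.

Lemma generic_ae : exchangeable xi -> general_position xi ->
  let G := [set w | forall (s : 'S_d.+1) (i : 'I_d.+1),
    walk_coef (x w \o s) (lift ord0 i) != 0] in
  measurable G /\ P (~` G) = 0%E.
Proof.
move=> Ex GP G.
pose N (si : 'S_d.+1 * 'I_d.+1) :=
  [set w | walk_coef (x w \o si.1) (lift ord0 si.2) = 0].
have NE : ~` G = \bigcup_(si in setT) N si.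
  apply/seteqP; split=> [w /= /existsNP[s /existsNP[i /negP]]|w [[s i] _ Nw] /(_ s i)].
    by rewrite negbK => /eqP siw; exists (s, i).
  by rewrite Nw eqxx.
have mN : measurable (~` G).
  rewrite NE; apply: fin_bigcup_measurable => [|si _]; first exact: finite_finset.
  exact: measurable_walk_coef0.
split; first by rewrite -(setCK G); exact: measurableC.
apply/negligibleP => //; rewrite NE.
rewrite (_ : \bigcup_(_ in _) _ = \big[setU/set0]_si N si).
  apply: (big_ind (fun A => P.-negligible A)) => [||[s i] _].
  - exact: negligible_set0.
  - exact: negligibleU.
  - apply/negligibleP; first exact: measurable_walk_coef0.
    exact: walk_coef_neq0_ae.
rewrite -bigcup_seq; apply/seteqP; split=> w [si _ Nw]; exists si => //=.
exact: mem_index_enum.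
Qed.

End ExchangeableWalk.

(** * The probability of each type *)

Theorem theorem3p17 (dsp : measure_display) (Omega : measurableType dsp)
    (R : realType) (P : probability Omega R) (d : nat) (hd : (1 <= d)%N)
    (xi : 'I_d.+1 -> {RV P >-> borel_rV R d})
    (Ex : exchangeable xi) (GP : general_position xi)
    (m : nat) (hm : (m <= d./2)%N) :
  measurable [set w | has_type d m (walk_hull xi w)] /\
  P [set w | has_type d m (walk_hull xi w)] =
    ((eta d m)%:R * ((d.+1)`!%:R^-1 * (eulerian d.+1 m)%:R))%:E.
Proof.
pose B := (fun t : d.+1.-tuple (borel_rV R d) =>
  sign_pattern m (walk_coef (tnth t : _ -> 'rV[R]_d))) @^-1` [set true].
have mB : measurable B.
  by rewrite -[X in measurable X]setTI; apply: measurable_sign_pattern.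
pose A s := permuted_increments xi s @^-1` B.
have mA s : measurable (A s).
  by rewrite -[X in measurable X]setTI; apply: measurable_permuted_increments.
(* The equivalence holds at every outcome, degenerate ones included, so the event is exactly a
   measurable preimage. *)
have -> : [set w | has_type d m (walk_hull xi w)] = A 1%g.
  apply/seteqP; split=> w; rewrite /A /B /= tnth_permuted_increments comp_perm1.
    by rewrite walk_hullE => /(has_type_walkP _ hd hm).
  by rewrite walk_hullE => /(has_type_walkP _ hd hm).
split; first exact: mA.
have [mG G0] := generic_ae Ex GP.
have PA : P (A 1%g) = (fine (P (A 1%g)))%:E by rewrite fineK // fin_num_measure.
(* The (d+1)! events [A s] are equally likely, and at a generic outcome exactly
   [eta d m * eulerian d.+1 m] of them occur. *)
have := @probability_count _ _ _ P _ A _ (eta d m * eulerian d.+1 m)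
  (fine (P (A 1%g))) mA mG G0.
rewrite card_Sn => count; rewrite PA; congr (_%:E).
have f0 : (d.+1)`!%:R != 0 :> R by rewrite pnatr_eq0 -lt0n fact_gt0.
apply: (mulfI f0); rewrite count.
- by rewrite natrM [RHS]mulrCA mulVKf.
- by move=> s; rewrite -PA; exact: probability_permuted_increments.
move=> w Gw; have [a_inj a0] := generic_minors hd Gw.
rewrite -(card_sign_pattern hd hm a_inj a0); apply: eq_card => s.
rewrite !inE /A /B.
(* The minors of the permuted increments are the permuted minors up to a factor, which the sign
   pattern ignores. *)
have [t t0 tP] : exists2 t, t != 0 &
    forall j, minors ((fun j => xi j w : 'rV[R]_d) \o s) j =
      t * minors (fun j => xi j w : 'rV[R]_d) (s j).
  by apply: minors_perm; exists ord0; exact: a0.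
rewrite -(sign_patternZ m t0 (cdiffZ tP)).
apply/idP/idP => [/set_mem|sw]; last apply: mem_set.
  by rewrite /= tnth_permuted_increments.
by rewrite /= tnth_permuted_increments.
Qed.
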